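(* Let $p\in(0,1)$ and assume that there exist positive constants $K_1$ and $K_2$ such that $$\mathbb E\big[(G_{X_1}(X_1))^2\exp\big((G_{X_1}(X_1))^p\big)\big]\le K_1\quad\text{and}\quad\mathbb E\big[(G_\varepsilon(\varepsilon))^2\exp\big((G_\varepsilon(\varepsilon))^p\big)\big]\le K_2.$$ Then there exist positive constants $A,B,C_0,D$ and $L$, not depending on $n$ and $x$, such that for all $n\ge1$ $$\mathbb P\Big(\big|W_1(\mu_n,\mu)-\mathbb E[W_1(\mu_n,\mu)]\big|>x\Big)\le\begin{cases}C_0\exp(-n^pAx^p)&\text{if }x\ge Ln^{-(1-p)/(2-p)},\\ D\exp(-nBx^2)&\text{if }x\in[0,Ln^{-(1-p)/(2-p)}].\end{cases}$$
   Context: $(\mathcal X,d)$ and $(\mathcal Y,\delta)$ are complete separable metric spaces; $(\varepsilon_i)_{i\ge1}$ is a sequence of iid $\mathcal Y$-valued random variables; $X_1$ is an $\mathcal X$-valued random variable independent of $(\varepsilon_i)_{i\ge2}$. The Markov chain is $X_n=F(X_{n-1},\varepsilon_n)$ for $n\ge2$, where $F:\mathcal X\times\mathcal Y\to\mathcal X$ is measurable and satisfies, for some $\rho\in[0,1)$ and $C>0$, $\mathbb E[d(F(x,\varepsilon_1),F(x',\varepsilon_1))]\le\rho\,d(x,x')$ for all $x,x'\in\mathcal X$, and $d(F(x,y),F(x,y'))\le C\,\delta(y,y')$ for all $x\in\mathcal X$, $y,y'\in\mathcal Y$. $\mu$ denotes the unique invariant distribution of the chain and $\mu_n=\frac1n\sum_{k=1}^n\delta_{X_k}$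 the empirical distribution (here $\delta_{X_k}$ is a Dirac mass). $G_{X_1}(x)=\int d(x,x')P_{X_1}(dx')$ and $G_\varepsilon(y)=\int C\,\delta(y,y')P_\varepsilon(dy')$, where $P_{X_1}$ is the law of $X_1$ and $P_\varepsilon$ the common law of the $\varepsilon_k$'s; $G_\varepsilon(\varepsilon)$ denotes a random variable distributed as $G_\varepsilon(\varepsilon_k)$. For probability measures $\nu_1,\nu_2$ on $(\mathcal X,d)$, $W_1(\nu_1,\nu_2)=\inf_{\lambda\in M(\nu_1,\nu_2)}\int d(x,y)\,\lambda(dx,dy)$, where $M(\nu_1,\nu_2)$ is the set of probability measures on $\mathcal X\times\mathcal X$ with margins $\nu_1$ and $\nu_2$. *)

(* Defs.v *)
From HB Require Import structures.
From mathcomp Require Import all_boot all_order all_algebra.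
From mathcomp Require Import all_classical all_reals all_analysis.

Set Implicit Arguments.
Unset Strict Implicit.
Unset Printing Implicit Defensive.

Import Order.TTheory GRing.Theory Num.Theory.
Import numFieldNormedType.Exports.

Local Open Scope classical_set_scope.
Local Open Scope ring_scope.

#[short(type="completeMetricType")]
HB.structure Definition CompleteMetric (R : numDomainType) :=
  {T of Metric R T & Complete T}.

Definition separable (T : topologicalType) :=
  exists2 S : set T, countable S & dense S.

Notation borel T := (g_sigma_algebraType (@open T)).

Section independence.
Local Open Scope ereal_scope.
Context d (Omega : measurableType d) (R : realType) (P : probability Omega R).
Context d' (T : measurableType d').

Definition mutually_independent (I : set nat) (X : nat -> {RV P >-> T}) :=
  forall J : seq nat, uniq J -> [set` J] `<=` I ->
  forall A : nat -> set T, (forall i, measurable (A i)) ->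
    P (\bigcap_(i in [set` J]) (X i @^-1` A i)) =
    \prod_(i <- J) P (X i @^-1` A i).

Definition identically_distributed (I : set nat) (X : nat -> {RV P >-> T}) :=
  forall i j, I i -> I j -> forall A : set T, measurable A ->
    distribution P (X i) A = distribution P (X j) A.

Definition sigma_family (I : set nat) (X : nat -> {RV P >-> T}) :
    set (set Omega) :=
  <<s \bigcup_(i in I) g_sigma_algebra_preimage (X i) >>.

Definition independent_of_family d'' (U : measurableType d'')
    (Z : {RV P >-> U}) (I : set nat) (X : nat -> {RV P >-> T}) :=
  forall (A : set U) (B : set Omega), measurable A -> sigma_family I X B ->
    P ((Z @^-1` A) `&` B) = P (Z @^-1` A) * P B.

End independence.

Section wasserstein.
Local Open Scope ereal_scope.
Context (R : realType) (T : completeMetricType R).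

Definition couplings (nu1 nu2 : {measure set (borel T) -> \bar R}) :
    set (probability (borel T * borel T)%type R) :=
  [set lam | forall A : set (borel T), measurable A ->
     lam (A `*` setT) = nu1 A /\ lam (setT `*` A) = nu2 A].

Definition W1 (nu1 nu2 : {measure set (borel T) -> \bar R}) : \bar R :=
  ereal_inf [set \int[lam]_z (@mdist R T z.1 z.2)%:E
            | lam in couplings nu1 nu2].

(* The points are x 1, ..., x n; x 0 is not used. For n = 0 this is the zero
   measure. *)
Definition empirical (n : nat) (x : nat -> T) :
    {measure set (borel T) -> \bar R} :=
  mscale ((n%:R^-1 : R)%:nng)%R (msum (fun k => \d_(x k.+1 : borel T)) n).

(* Kept in \bar R: taking the real part of an infinite mean distance would
   turn a failing moment condition into a satisfied one. *)
Definition mean_dist (c : R) (nu : probability (borel T) R) (x : T) : \bar R :=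
  \int[nu]_x' (c * @mdist R T x x')%:E.

End wasserstein.

Section markov.
Local Open Scope ereal_scope.
Context (R : realType) (T S : completeMetricType R).

(* nu is the law of the innovations, so the integrand is the transition kernel
   A |-> P(F(x, eps) \in A). Under the contraction hypothesis at most one mu is
   invariant (couple two copies of the chain through the same innovations). *)
Definition invariant_law (F : T * S -> T) (nu : probability (borel S) R)
    (mu : probability (borel T) R) :=
  forall A : set (borel T), measurable A ->
    \int[mu]_x nu [set y | A (F (x, y))] = mu A.

End markov.

(* Main.v *)
Require Import Defs.
From HB Require Import structures.
From mathcomp Require Import all_boot all_order all_algebra.
From mathcomp Require Import all_classical all_reals all_analysis.
From mathcomp Require Import measurable_realfun lra ring.

Set Implicit Arguments.
Unset Strict Implicit.
Unset Printing Implicit Defensive.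

Import Order.TTheory GRing.Theory Num.Theory.
Import numFieldNormedType.Exports.

Local Open Scope classical_set_scope.
Local Open Scope ring_scope.

(** Why the theorem is true.

Put kappa = 1 / (1 - rho).  The functional f = n W_1(mu_n, mu) is Lipschitz of
constant 1 in each of its n arguments, because a coupling with mu can be
transported from one sample to another ([transport_coupling],
[rW1_lipschitz]).  Averaging out the last innovation of such a functional
leaves a functional of one point less, still of constant 1 in all arguments
except the last one, where the constant stays below kappa by contraction
([lip_step], using 1 + kappa rho = kappa).  The successive averages write
f - E f as a sum of martingale differences, the k-th one being bounded by
kappa G(eps_k), a function of the k-th innovation alone ([next_deviation]).

The G(eps_k) have only a semi-exponential moment, so the differences D_k are
cut off from above at a level u.  If l u^(1-p) <= 1/kappa, then
l min(D, u) <= G^p on D > 0, and the inequality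
exp(y) <= 1 + y + y^2 exp(max(y, 0)) gives
   exp(l min(D, u)) <= 1 + l D + l^2 kappa^2 G^2 exp(G^p)
([expR_truncated]).  The mean of D is 0 and the last term is controlled by the
moment hypothesis, so the conditional Laplace transform of each cut-off
difference is at most exp(l^2 V) with V = kappa^2 (K1 + K2)
([laplace_truncated], [laplace_next], [chain_laplace]).  Chernoff's bound,
together with a union bound for the event that some kappa G(eps_k) exceeds u,
yields
   P(|f - E f| > t) <= 2 (n V u^-2 exp(- u^p / kappa) + exp(n l^2 V - l t))
([chain_deviation_abs]).

With c = 1 / (kappa + 2 V) and t = n x, the two regimes of the theorem are the
two choices u = t, l = c t^(p-1) for t >= n^(1/(2-p)), and u = n^(1/(2-p)),
l = c t / n for t <= n^(1/(2-p)) ([large_deviation_rate],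
[moderate_deviation_rate]).

Two points have to be settled before this argument makes sense.  The random
variables involved must be measurable: a function of finitely many points that
is Lipschitz is an infimum of countably many distance functions, by
separability ([measurable_lipschitz]).  And W_1(mu_n, mu) must be finite, which
holds since an invariant law has a finite first moment
([invariant_first_moment]). *)

(** * Measurability of Lipschitz functions on a separable metric space *)

Lemma measurable_fun_lt_cst (R : realType) d (U : measurableType d)
    (f : U -> R) :
  (forall a, measurable [set w | f w < a]) -> measurable_fun setT f.
Proof.
move=> mf; apply: (measurability _ (RGenInftyO.measurableE R)) => //.
move=> _ [_ [a ->] <-]; rewrite setTI.
suff -> : f @^-1` `]-oo, a[ = [set w | f w < a] by [].
by apply/seteqP; split => w /=; rewrite in_itv.
Qed.

Section measurability.
Context (R : realType) (T : completeMetricType R) (sepT : separable T).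

Lemma dense_sequence : exists q : nat -> T,
  forall x e, 0 < e -> exists j, mdist x (q j) < e.
Proof.
have [S cS dS] := sepT.
have hit x e : 0 < e -> exists2 y, S y & mdist x y < e.
  move=> e0.
  have /dS : (interior (ball x e)) !=set0.
    by exists x; exact: nbhsx_ballx.
  move=> /(_ (@open_interior _ _))[y [/interior_subset]].
  by rewrite ballEmdist/= => xy Sy; exists y.
have [|[q]] := pfcard_geP cS.
  move=> S0; exists (fun=> point : borel T) => x e /(hit x)[y].
  by rewrite S0.
exists q => x e /(hit x)[y Sy xy].
by have [j _ jy] := 'surj_q Sy; exists j; rewrite jy.
Qed.

Lemma measurable_ball (x : T) (e : R) :
  measurable ([set y | mdist x y < e] : set (borel T)).
Proof.
apply: sub_sigma_algebra; rewrite -ballEmdist openE => y.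
rewrite ballEmdist/= => xy; rewrite /interior -nbhs_ballE.
exists (e - mdist x y) => /=; first by rewrite subr_gt0.
move=> z; rewrite !ballEmdist/= => yz.
by rewrite (le_lt_trans (metric_triangle _ y _))// -ltrBrDl.
Qed.

Lemma measurable_mdistr (x : T) :
  measurable_fun setT (fun y : borel T => mdist x y).
Proof. by apply: measurable_fun_lt_cst => a; exact: measurable_ball. Qed.

(** The sublevel set f < a is the countable union, over the finite sequences q
    of points of a dense sequence, of the sets f q + c sum d(q_i, x_i) < a: the
    left side bounds f x by the Lipschitz property, and is arbitrarily close to
    it when q is close to x. *)
Lemma measurable_lipschitz d (U : measurableType d) (n : nat) (c : R)
    (f : (nat -> T) -> R) (V : nat -> U -> borel T) :
  0 <= c ->
  (forall i, (i < n)%N -> measurable_fun setT (V i)) ->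
  (forall z z', `|f z - f z'| <= c * \sum_(i < n) mdist (z i) (z' i)) ->
  measurable_fun setT (fun w => f (V ^~ w)).
Proof.
move=> c0 mV fL; have [q qP] := dense_sequence.
pose pt (j : nat) (i : nat) := q (nth 0%N (odflt [::] (unpickle j)) i).
apply: measurable_fun_lt_cst => a.
rewrite [X in measurable X](_ : _ = \bigcup_j [set w |
    f (pt j) + c * \sum_(i < n) mdist (pt j i) (V i w) < a]); last first.
  apply/seteqP; split => [w /= fwa|w [j _ /=]]; last first.
    apply: le_lt_trans; rewrite -lerBlDl (le_trans (ler_norm _))//.
    rewrite (le_trans (fL _ _))// ler_wpM2l//.
    by apply: ler_sum => i _; rewrite metric_sym.
  (* With every d(q_i, x_i) below e the left side is at most
     f x + 2 c n e, which is less than a; the added 1 keeps the denominator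
     positive and the inequality strict. *)
  pose e := (a - f (V ^~ w)) / (2 * c * n%:R + 1).
  have d0 : 0 < 2 * c * n%:R + 1 by rewrite ltr_wpDl// !mulr_ge0.
  have e0 : 0 < e by rewrite divr_gt0// subr_gt0.
  have /choice[J JP] : forall i, exists j, mdist (V i w) (q j) < e.
    by move=> i; exact: qP.
  exists (pickle (mkseq J n)) => //=.
  set z := pt _.
  have zE i : (i < n)%N -> z i = q (J i).
    by move=> ni; rewrite /z /pt pickleK/= nth_mkseq.
  have Se : \sum_(i < n) mdist (z i) (V i w) <= n%:R * e.
    rewrite mulr_natl -[in leRHS](card_ord n) -sumr_const.
    by apply: ler_sum => i _; rewrite zE// metric_sym ltW.
  have := fL z (V ^~ w); rewrite ler_norml => /andP[_].
  rewrite lerBlDr => fz.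
  have cS : c * \sum_(i < n) mdist (z i) (V i w) <= c * (n%:R * e).
    exact: ler_wpM2l.
  have eE : (2 * c * n%:R + 1) * e = a - f (V ^~ w).
    by rewrite mulrC /e divfK// gt_eqF.
  have : (2 * c * n%:R + 1) * e = 2 * (c * (n%:R * e)) + e by ring.
  move: fz cS eE e0; lra.
apply: bigcupT_measurable => j.
have mS : measurable_fun setT
    (fun w => f (pt j) + c * \sum_(i < n) mdist (pt j i) (V i w)).
  apply: measurable_funD; first exact: measurable_cst.
  apply: measurable_funM; first exact: measurable_cst.
  apply: measurable_sum => i.
  apply: (measurableT_comp (measurable_mdistr _)); exact: mV.
rewrite -[X in measurable X]setTI.
have -> : [set w | f (pt j) + c * \sum_(i < n) mdist (pt j i) (V i w) < a] =
  (fun w => f (pt j) + c * \sum_(i < n) mdist (pt j i) (V i w)) @^-1` `]-oo, a[.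
  by apply/seteqP; split => w /=; rewrite in_itv.
exact: mS.
Qed.

End measurability.

(** * Integration against independent variables and laws *)

Definition to_mfun d d' (T : measurableType d) (T' : measurableType d')
    (f : T -> T') (mf : measurable_fun setT f) : {mfun T >-> T'} :=
  HB.pack f (isMeasurableFun.Build _ _ _ _ f mf).

(** The variable U stands for the past of the chain and V for the next
    innovation, of law nu. *)
Section independence_fubini.
Local Open Scope ereal_scope.
Context (R : realType) d d1 d2 (Om : measurableType d)
  (T1 : measurableType d1) (T2 : measurableType d2).
Context (P : probability Om R) (nu : probability T2 R).
Context (U : Om -> T1) (mU : measurable_fun setT U).
Context (V : Om -> T2) (mV : measurable_fun setT V).
Hypothesis UV : forall A B, measurable A -> measurable B ->
  P (U @^-1` A `&` V @^-1` B) = P (U @^-1` A) * nu B.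

Let X : {mfun Om >-> T1} := to_mfun mU.
Let Z : {mfun Om >-> (T1 * T2)%type} := to_mfun (measurable_fun_pair mU mV).

Lemma independent_joint_law (A : set (T1 * T2)) : measurable A ->
  distribution P Z A = (distribution P X \x nu) A.
Proof.
move=> mA; apply/esym.
by apply: (@product_measure_unique _ _ T1 T2 R (distribution P X) nu
  (distribution P Z)) => // B C mB mC; exact: UV.
Qed.

(** The joint law of (U, V) is a product measure. *)
Lemma independent_tonelli (g : T1 * T2 -> \bar R) :
  measurable_fun setT g -> (forall z, 0 <= g z) ->
  \int[P]_w g (U w, V w) = \int[P]_w \int[nu]_y g (U w, y).
Proof.
move=> mg g0.
transitivity (\int[distribution P Z]_z g z).
  by rewrite ge0_integral_distribution.
rewrite (eq_measure_integral (distribution P X \x nu)); last first.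
  by move=> A mA _; exact: independent_joint_law.
rewrite fubini_tonelli1// ge0_integral_distribution//.
  exact: measurable_fun_fubini_tonelli_F.
by move=> x; exact: integral_ge0.
Qed.

Lemma independent_fubini (g : T1 * T2 -> R) :
  measurable_fun setT g -> P.-integrable setT (fun w => (g (U w, V w))%:E) ->
  \int[P]_w (g (U w, V w))%:E = \int[P]_w \int[nu]_y (g (U w, y))%:E.
Proof.
move=> mg ig.
have mg' : measurable_fun setT (EFin \o g) by exact/measurable_EFinP.
transitivity (\int[distribution P Z]_z (g z)%:E).
  by rewrite (@integral_distribution _ _ _ _ _ P Z _ mg').
have ig2 : (distribution P X \x nu).-integrable setT (EFin \o g).
  apply/integrableP; split => //.
  rewrite (eq_measure_integral (distribution P Z)); last first.
    by move=> A mA _; exact/esym/independent_joint_law.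
  rewrite (@ge0_integral_distribution _ _ _ _ _ P Z) //; last first.
    exact: measurableT_comp.
  by move/integrableP : ig => [].
rewrite (eq_measure_integral (distribution P X \x nu)); last first.
  by move=> A mA _; exact: independent_joint_law.
rewrite -integral12_prod_meas1//.
have iF := integrable_fubini_F ig2.
have mF : measurable_fun setT (fubini_F nu (EFin \o g)).
  exact: measurable_fubini_F ig2.
have iFX : P.-integrable setT (fubini_F nu (EFin \o g) \o X).
  apply/integrableP; split; first exact: measurableT_comp mF mU.
  rewrite -(@ge0_integral_distribution _ _ _ _ _ P X
    (fun x => `|fubini_F nu (EFin \o g) x|)) //.
    by move/integrableP : iF => [].
  exact: measurableT_comp.
by rewrite (@integral_distribution _ _ _ _ _ P X _ mF).
Qed.

End independence_fubini.

Section law.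
Local Open Scope ereal_scope.
Context (R : realType) d d' (Om : measurableType d) (T : measurableType d').
Context (P : probability Om R) (V : Om -> T) (mV : measurable_fun setT V).
Context (nu : probability T R).
Hypothesis law : forall A, measurable A -> P (V @^-1` A) = nu A.

Lemma ge0_integral_law (h : T -> \bar R) : measurable_fun setT h ->
  (forall x, 0 <= h x) -> \int[P]_w h (V w) = \int[nu]_x h x.
Proof.
move=> mh h0.
rewrite -(@ge0_integral_distribution _ _ _ _ _ P (to_mfun mV))//.
by apply: eq_measure_integral => A mA _; exact: law.
Qed.

Lemma integrable_law (h : T -> \bar R) :
  nu.-integrable setT h -> P.-integrable setT (fun w => h (V w)).
Proof.
move=> /integrableP[mh ih]; apply/integrableP; split.
  exact: (measurableT_comp mh mV).
by rewrite (ge0_integral_law (h := fun x => `|h x|))//; exact: measurableT_comp.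
Qed.

Lemma integral_law (h : T -> \bar R) : nu.-integrable setT h ->
  \int[P]_w h (V w) = \int[nu]_x h x.
Proof.
move=> ih.
rewrite -(@integral_distribution _ _ _ _ _ P (to_mfun mV))//.
- by apply: eq_measure_integral => A mA _; exact: law.
- exact: measurable_int ih.
- exact: integrable_law.
Qed.

End law.

(** * An exponential inequality for truncated variables *)

(** From 1 - y <= exp(- y) one gets exp(y) (1 - y) <= 1.  For y > 0 this reads
    exp(y) <= 1 + y exp(y), and is inserted into itself once; for y <= 0 one
    divides by 1 - y and uses (1 + y + y^2) (1 - y) = 1 - y^3 >= 1. *)
Lemma expR_le_quadratic (R : realType) (y : R) :
  expR y <= 1 + y + y ^+ 2 * expR (Num.max y 0).
Proof.
have [y0|y0] := leP y 0.
  rewrite expR0 mulr1.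
  have h : expR y * expR (- y) = 1 by rewrite -expRD subrr expR0.
  have := expR_ge1Dx (- y); have := expR_gt0 y.
  have : 0 <= 1 + y + y ^+ 2.
    by have := sqr_ge0 (2 * y + 1); rewrite !expr2; nra.
  move: h; set a := expR y; set b := expR (- y); set q := 1 + y + y ^+ 2.
  move=> ab q0 a0 hb.
  have : a * (1 - y) <= 1 by rewrite -[leRHS]ab ler_wpM2l// ltW.
  have : 1 <= q * (1 - y).
    have -> : q * (1 - y) = 1 - y ^+ 3 by rewrite /q; ring.
    by rewrite lerDl oppr_ge0 exprn_odd_le0.
  nra.
have h : expR y * expR (- y) = 1 by rewrite -expRD subrr expR0.
have := expR_ge1Dx (- y); have := expR_gt0 y.
move: h; set a := expR y; set b := expR (- y) => ab a0 hb.
have : a * (1 - y) <= 1 by rewrite -[leRHS]ab ler_wpM2l// ltW.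
nra.
Qed.

Section truncation.
Context (R : realType) (p : R) (p0 : 0 < p) (p1 : p < 1).

(** For m = min(D, u) > 0, l m = l m^(1-p) m^p <= kappa^-1 (kappa g)^p <= g^p.
    Truncation only from above costs nothing in the linear term, since
    min(D, u) <= D. *)
Lemma expR_truncated (kappa u l D g : R) : 1 <= kappa -> 0 < u -> 0 <= l ->
  l * u `^ (1 - p) <= kappa^-1 -> `|D| <= kappa * g ->
  expR (l * Num.min D u) <=
  1 + l * D + l ^+ 2 * kappa ^+ 2 * (g ^+ 2 * expR (g `^ p)).
Proof.
move=> k1 u0 l0 lu Dg.
have k0 : 0 < kappa by exact: lt_le_trans k1.
have g0 : 0 <= g by rewrite -(pmulr_rge0 _ k0) (le_trans _ Dg).
set y := l * _; apply: (le_trans (expR_le_quadratic y)).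
have y2 : y ^+ 2 <= l ^+ 2 * kappa ^+ 2 * g ^+ 2.
  rewrite /y exprMn -mulrA ler_wpM2l ?sqr_ge0//.
  have mg : `|Num.min D u| <= kappa * g.
    rewrite (le_trans _ Dg)//; have [//|uD] := leP D u.
    by rewrite !gtr0_norm// ?ltW// (lt_trans u0).
  rewrite -exprMn -[leLHS]real_normK ?num_real//.
  by rewrite lerXn2r ?nnegrE// mulr_ge0// ltW.
have ymax : Num.max y 0 <= g `^ p.
  rewrite ge_max powR_ge0 andbT /y.
  have [D0|D0] := leP (Num.min D u) 0.
    by rewrite (le_trans _ (powR_ge0 _ _))// mulr_ge0_le0.
  set m := Num.min D u in D0 *.
  have mu' : m <= u by rewrite ge_min lexx orbT.
  have mg : m <= kappa * g.
    by rewrite (le_trans _ Dg)// (le_trans _ (ler_norm _))// ge_min lexx.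
  rewrite -[X in l * X](powRr1 (ltW D0)) -(subrK p 1) powRD; last first.
    by rewrite (gt_eqF D0) implybT.
  rewrite mulrA.
  apply: (@le_trans _ _ (kappa^-1 * (kappa * g) `^ p)).
    apply: ler_pM; rewrite ?mulr_ge0 ?powR_ge0//.
      rewrite (le_trans _ lu)// ler_wpM2l//.
      by apply: ge0_ler_powR => //; rewrite ?nnegrE ?subr_ge0 ltW.
    by apply: ge0_ler_powR => //; rewrite ?nnegrE ?mulr_ge0 // ltW.
  rewrite (powRM _ (ltW k0) g0) mulrA -[leRHS]mul1r ler_wpM2r ?powR_ge0//.
  rewrite ler_pdivrMl// mulr1 -[leRHS](powRr1 (ltW k0)).
  by rewrite ler_powR// ltW.
have yD : y <= l * D by rewrite ler_wpM2l// ge_min lexx.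
rewrite lerD ?lerD2l// mulrA ler_pM ?sqr_ge0 ?expR_ge0//.
by rewrite ler_expR.
Qed.

End truncation.

(** * Lipschitz functions of one variable *)

Lemma integral_probability_cst d (T : measurableType d) (R : realType)
    (P : probability T R) (r : \bar R) : (\int[P]_x r = r)%E.
Proof. by rewrite integral_cst//= probability_setT mule1. Qed.

Lemma integrable_probability_cst d (T : measurableType d) (R : realType)
    (P : probability T R) (r : R) : P.-integrable setT (fun=> r%:E).
Proof. exact: finite_measure_integrable_cst. Qed.

(** A pseudometric for which Lipschitz functions of finitely many measurable
    points are measurable: the only property of a separable metric space with
    its Borel sets that the probabilistic part needs.  It also absorbs the
    constant of the Lipschitz hypothesis on F, the distance on the innovations
    being C times the metric. *)
Record measurable_distance (R : realType) d (T : measurableType d)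
    (dist : T -> T -> R) : Prop := MeasurableDistance {
  distance_ge0 : forall x y, 0 <= dist x y;
  distance_xx : forall x, dist x x = 0;
  distance_sym : forall x y, dist x y = dist y x;
  distance_triangle : forall x y z, dist x z <= dist x y + dist y z;
  distance_lipschitz : forall d' (U : measurableType d') (n : nat) (c : R)
      (f : (nat -> T) -> R) (V : nat -> U -> T), 0 <= c ->
    (forall i, (i < n)%N -> measurable_fun setT (V i)) ->
    (forall z z', `|f z - f z'| <= c * \sum_(i < n) dist (z i) (z' i)) ->
    measurable_fun setT (fun w => f (V ^~ w)) }.

Lemma measurable_distance_metric (R : realType) (T : completeMetricType R)
    (c : R) : separable T -> 0 < c ->
  measurable_distance (fun x y : borel T => c * mdist (x : T) y).
Proof.
move=> sepT c0; split.
- by move=> x y; apply: mulr_ge0; [exact: ltW|exact: mdist_ge0].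
- by move=> x; rewrite mdistxx mulr0.
- by move=> x y; rewrite metric_sym.
- by move=> x y z; rewrite -mulrDr; apply: ler_wpM2l; [exact: ltW|exact: metric_triangle].
move=> d' U n b f V b0 mV fL.
apply: (@measurable_lipschitz _ _ sepT _ _ n (b * c)) => //.
  by apply: mulr_ge0 => //; exact: ltW.
by move=> z z'; rewrite -mulrA mulr_sumr; exact: fL.
Qed.

Lemma measurable_distance2 (R : realType) d (T : measurableType d)
    (dist : T -> T -> R) d' (U : measurableType d') (f g : U -> T) :
  measurable_distance dist ->
  measurable_fun setT f -> measurable_fun setT g ->
  measurable_fun setT (fun w => dist (f w) (g w)).
Proof.
move=> Hd mf mg.
pose V (i : nat) := if i is 0%N then f else g.
apply: (@distance_lipschitz _ _ _ _ Hd _ U 2 1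
  (fun z => dist (z 0%N) (z 1%N)) V) => //.
  by case=> [|i] _.
move=> z z'; rewrite 2!big_ord_recr/= big_ord0 add0r mul1r.
have h (a b a' b' : T) : dist a b - dist a' b' <= dist a a' + dist b b'.
  have := distance_triangle Hd a a' b; have := distance_triangle Hd a' b' b.
  rewrite (distance_sym Hd b' b); lra.
rewrite ler_norml h andbT lerNl opprB (le_trans (h _ _ _ _))//.
by rewrite (distance_sym Hd (z' _)) (distance_sym Hd (z' 1%N)).
Qed.

Definition mean_distance (R : realType) d (T : measurableType d)
    (nu : probability T R) (dist : T -> T -> R) (x : T) : \bar R :=
  (\int[nu]_y (dist x y)%:E)%E.

Definition moment_bound (R : realType) d (T : measurableType d)
    (nu : probability T R) (dist : T -> T -> R) (p K : R) : Prop :=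
  (\int[nu]_x (mean_distance nu dist x ^+ 2 *
     expeR (mean_distance nu dist x `^ p)) <= K%:E)%E.

Section one_variable.
Context (R : realType) d (T : measurableType d) (nu : probability T R).
Context (dist : T -> T -> R) (Hdist : measurable_distance dist).

Let G := mean_distance nu dist.

Let dist_ge0 := distance_ge0 Hdist.
Let dist_sym := distance_sym Hdist.
Let dist_triangle := distance_triangle Hdist.

Lemma measurable_lipschitz1 (k : R) (g : T -> R) : 0 <= k ->
  (forall x x', `|g x - g x'| <= k * dist x x') -> measurable_fun setT g.
Proof.
move=> k0 gL.
apply: (distance_lipschitz Hdist (n := 1) (f := fun z => g (z 0%N))
  (V := fun=> id) k0) => // z z'.
by rewrite big_ord1.
Qed.

Let dist_lipschitz x y y' : `|dist x y - dist x y'| <= 1 * dist y y'.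
Proof.
have := dist_triangle x y y'; have := dist_triangle x y' y.
by rewrite (dist_sym y' y) mul1r => h1 h2; rewrite ler_distlC; apply/andP; split; lra.
Qed.

Lemma measurable_distance_from x : measurable_fun setT (dist x).
Proof. by apply: (@measurable_lipschitz1 1) => // y y'; exact: dist_lipschitz. Qed.

Let mdist_r := measurable_distance_from.

Lemma mean_distance_triangle x y : (G x <= (dist x y)%:E + G y)%E.
Proof.
rewrite -[X in (X + _)%E](integral_probability_cst nu) -ge0_integralD//=.
- apply: ge0_le_integral => //=.
  + by move=> z _; rewrite lee_fin.
  + exact/measurable_EFinP.
  + by apply: emeasurable_funD => //; exact/measurable_EFinP.
  + by move=> z _; rewrite -EFinD lee_fin.
- by move=> z _; rewrite lee_fin.
- by move=> z _; rewrite lee_fin.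
- exact/measurable_EFinP.
Qed.

Lemma mean_distance_ge0 x : (0 <= G x)%E.
Proof. by apply: integral_ge0 => y _; rewrite lee_fin. Qed.

(** By the triangle inequality the mean distance is either finite everywhere or
    infinite everywhere; a finite moment excludes the second case. *)
Lemma mean_distance_infinite x y : G x = +oo%E -> G y = +oo%E.
Proof. by move=> Gx; have := mean_distance_triangle x y; rewrite Gx leye_eq; case: (G y). Qed.

Lemma fine_mean_distance_lipschitz : (forall x, G x \is a fin_num) ->
  forall x x', `|fine (G x) - fine (G x')| <= dist x x'.
Proof.
move=> Gfin x x'.
have := mean_distance_triangle x x'; have := mean_distance_triangle x' x.
rewrite -[G x]fineK// -[G x']fineK// -!EFinD !lee_fin (dist_sym x' x) => h1 h2.
by rewrite ler_distlC; apply/andP; split; lra.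
Qed.

(** Change of variables for the moment hypotheses.  The integrand is known to be
    measurable once the mean distance is finite, and it is constantly infinite
    otherwise. *)
Lemma moment_bound_law d' (Om : measurableType d') (P : probability Om R)
    (V : Om -> T) (p k : R) : measurable_fun setT V ->
  (forall A, measurable A -> P (V @^-1` A) = nu A) -> 0 < p ->
  (\int[P]_w (G (V w) ^+ 2 * expeR (G (V w) `^ p)) <= k%:E)%E ->
  moment_bound nu dist p k.
Proof.
move=> mV law p0.
have [[x Gx]|Gfin] := pselect (exists x, G x = +oo%E).
  under eq_integral do rewrite (mean_distance_infinite _ Gx) poweRyr ?gt_eqF//=.
  by rewrite integral_probability_cst.
have {}Gfin x : G x \is a fin_num.
  rewrite ge0_fin_numE ?mean_distance_ge0// ltey; apply/eqP => Gx.
  by apply: Gfin; exists x.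
pose gam x := fine (G x).
have mgam : measurable_fun setT gam.
  apply: (@measurable_lipschitz1 1) => // x x'.
  by rewrite mul1r; exact: fine_mean_distance_lipschitz.
pose q x := (gam x ^+ 2 * expR (gam x `^ p))%:E.
have qE x : (G x ^+ 2 * expeR (G x `^ p) = q x)%E.
  by rewrite -[G x]fineK// poweR_EFin.
have mq : measurable_fun setT q.
  apply/measurable_EFinP; apply: measurable_funM.
    exact: (measurable_funX 2 mgam).
  by apply: measurableT_comp => //; exact: (measurableT_comp (measurable_powR p) mgam).
under eq_integral do rewrite qE.
rewrite (ge0_integral_law mV law mq); last first.
  by move=> x; rewrite lee_fin mulr_ge0 ?sqr_ge0 ?expR_ge0.
by apply: le_trans; under eq_integral do rewrite -/(G _) qE.
Qed.

Section moment.
Context (p : R) (p0 : 0 < p) (p1 : p < 1) (K : R).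
Hypothesis moment : moment_bound nu dist p K.

Lemma mean_distance_fin_num x : G x \is a fin_num.
Proof.
rewrite ge0_fin_numE ?mean_distance_ge0// ltey; apply/eqP => Gx.
have Gy y : G y = +oo%E.
  exact: mean_distance_infinite Gx.
move: moment; rewrite /moment_bound (eq_integral (cst +oo%E)); last first.
  move=> y _; rewrite -/(G y) Gy poweRyr ?gt_eqF//=.
by rewrite integral_probability_cst.
Qed.

Let gam x := fine (G x).

Let gamE x : G x = (gam x)%:E.
Proof. by rewrite fineK// mean_distance_fin_num. Qed.

Lemma mean_distance_lipschitz x x' : `|gam x - gam x'| <= dist x x'.
Proof.
exact: fine_mean_distance_lipschitz mean_distance_fin_num x x'.
Qed.

Let mgam : measurable_fun setT (gam : T -> R).
Proof. by apply: (@measurable_lipschitz1 1) => // x x'; rewrite mul1r mean_distance_lipschitz. Qed.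

Lemma integrable_distance x : nu.-integrable setT (fun y => (dist x y)%:E).
Proof.
apply/integrableP; split.
  exact/measurable_EFinP.
under eq_integral do rewrite gee0_abs ?lee_fin//.
by rewrite -ge0_fin_numE ?mean_distance_fin_num// mean_distance_ge0.
Qed.

Lemma gamRE x : gam x = \int[nu]_y (dist x y).
Proof. by []. Qed.

Section lipschitz_function.
Context (kappa : R) (kappa1 : 1 <= kappa) (g : T -> R).
Hypothesis gL : forall x x', `|g x - g x'| <= kappa * (dist x x').

Let kappa0 : 0 < kappa. Proof. exact: lt_le_trans kappa1. Qed.

Let mg : measurable_fun setT (g : T -> R).
Proof. exact: (@measurable_lipschitz1 kappa (g : T -> R) (ltW kappa0) gL). Qed.

Lemma integrable_lipschitz : nu.-integrable setT (fun y => (g y)%:E).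
Proof.
pose x0 : T := point.
apply: (@le_integrable _ _ _ nu setT measurableT _
  (fun y => (`|g x0| + kappa * dist x0 y)%:E)).
- exact/measurable_EFinP.
- move=> y _; rewrite lee_fin [leRHS]ger0_norm; last first.
    by rewrite addr_ge0// mulr_ge0// ltW.
  rewrite -lerBlDl (le_trans (lerB_dist _ _))//.
  by rewrite (le_trans (gL _ _))// dist_sym.
- have i1 := integrable_probability_cst nu `|g x0|.
  have i2 := integrableZl measurableT kappa (integrable_distance x0).
  have i3 := integrableD measurableT i1 i2.
  exact: i3.
Qed.

Let m := \int[nu]_y g y.

(** g x minus its mean is the mean over y of g x - g y, which is at most
    kappa dist x y. *)
Lemma lipschitz_deviation x : `|g x - m| <= kappa * gam x.
Proof.
have -> : g x - m = \int[nu]_y (g x - g y).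
  rewrite RintegralB//; last first.
  - exact: integrable_lipschitz.
  - exact: integrable_probability_cst.
  by rewrite Rintegral_cst//= probability_setT/= mulr1.
have ig : nu.-integrable setT (EFin \o (fun y => g x - g y)).
  exact: (integrableB measurableT (integrable_probability_cst nu (g x))
    integrable_lipschitz).
apply: (le_trans (le_normr_Rintegral _ _)) => //.
rewrite gamRE -RintegralZl//; last exact: integrable_distance.
apply: le_Rintegral => //.
- exact: (integrable_norm ig).
- exact: (integrableZl measurableT kappa (integrable_distance x)).
Qed.

Let q x := gam x ^+ 2 * expR (gam x `^ p).

Let mq : measurable_fun setT q.
Proof.
apply: measurable_funM; first exact: (measurable_funX 2 mgam).
by apply: measurableT_comp => //; exact: (measurableT_comp (measurable_powR p) mgam).
Qed.

Let q_ge0 x : 0 <= q x.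
Proof. by rewrite mulr_ge0 ?sqr_ge0 ?expR_ge0. Qed.

Let qK : (\int[nu]_x (q x)%:E <= K%:E)%E.
Proof.
apply: le_trans (moment : (_ <= _)%E); rewrite le_eqVlt; apply/orP; left; apply/eqP.
by apply: eq_integral => x _; rewrite -/(G x) gamE poweR_EFin.
Qed.

(** Integrating [expR_truncated]: the linear term vanishes because g - m has
    mean zero, and 1 + a <= exp(a). *)
Lemma laplace_truncated (u l : R) : 0 < u -> 0 <= l ->
  l * u `^ (1 - p) <= kappa^-1 ->
  (\int[nu]_x (expR (l * Num.min (g x - m) u))%:E
     <= (expR (l ^+ 2 * (kappa ^+ 2 * K)))%:E)%E.
Proof.
move=> u0 l0 lu.
have iq : nu.-integrable setT (fun x => (q x)%:E).
  apply/integrableP; split; first exact/measurable_EFinP.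
  under eq_integral do rewrite gee0_abs ?lee_fin//.
  by rewrite (le_lt_trans qK)// ltry.
have ig := integrable_lipschitz.
have igm : nu.-integrable setT (fun x => (g x - m)%:E).
  exact: (integrableB measurableT ig (integrable_probability_cst nu m)).
have mm : measurable_fun setT (fun x : T => Num.min (g x - m) u).
  by apply: measurable_minr => //; exact: measurable_funB.
set a := l ^+ 2 * kappa ^+ 2.
have ilin : nu.-integrable setT (fun x => (1 + l * (g x - m))%:E).
  exact: (integrableD measurableT (integrable_probability_cst nu 1)
    (integrableZl measurableT l igm)).
have iaq : nu.-integrable setT (fun x => (a * q x)%:E).
  exact: (integrableZl measurableT a iq).
have mean0 : (\int[nu]_x (g x - m)%:E = 0)%E.
  rewrite (integralB_EFin measurableT ig (integrable_probability_cst nu m)).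
  rewrite integral_probability_cst /m /Rintegral fineK ?subee//.
    exact: integrable_fin_num.
  exact: integrable_fin_num.
apply: (@le_trans _ _ (\int[nu]_x (1 + l * (g x - m) + a * q x)%:E)%E).
  apply: ge0_le_integral => //=.
  - apply/measurable_EFinP; apply: measurableT_comp => //.
    exact: measurable_funM.
  - apply/measurable_EFinP; apply: measurable_funD; last exact: measurable_funM.
    apply: measurable_funD => //; apply: measurable_funM => //.
    exact: measurable_funB.
  - move=> x _; rewrite lee_fin; apply: expR_truncated => //.
    exact: lipschitz_deviation.
have il : nu.-integrable setT (fun x => (l * (g x - m))%:E).
  exact: (integrableZl measurableT l igm).
have e1 : (\int[nu]_x (l * (g x - m))%:E = 0)%E.
  by rewrite (integralZl measurableT igm l) mean0 mule0.
have e2 : (\int[nu]_x (a * q x)%:E = a%:E * \int[nu]_x (q x)%:E)%E.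
  exact: (integralZl measurableT iq a).
rewrite (integralD_EFin measurableT ilin iaq) e2.
rewrite (integralD_EFin measurableT (integrable_probability_cst nu 1) il) e1.
rewrite integral_probability_cst adde0.
apply: (@le_trans _ _ (1 + a * K)%:E).
  rewrite EFinD; apply: leeD => //; rewrite (EFinM a K); apply: lee_wpmul2l => //.
  by rewrite lee_fin /a mulr_ge0 ?sqr_ge0.
by rewrite lee_fin mulrA expR_ge1Dx.
Qed.

Lemma measurable_gt_mean_distance (u : R) :
  measurable [set x : T | u < kappa * gam x].
Proof.
rewrite [X in measurable X](_ : _ = ~` [set x | kappa * gam x <= u]); last first.
  by apply/seteqP; split => x /=; rewrite ltNge => /negP.
apply: measurableC; rewrite -[X in measurable X]setTI.
by apply: measurable_fun_le => //; apply: measurable_funM.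
Qed.

(** Markov's inequality for gam^2 exp(gam^p), which is increasing in gam; the
    exponent uses kappa^p <= kappa. *)
Lemma mean_distance_tail (u : R) : 0 < u ->
  (nu [set x : T | (u < kappa * gam x)%R] <=
   (kappa ^+ 2 * K * u ^- 2 * expR (- (u `^ p / kappa)))%:E)%E.
Proof.
move=> u0; set E := [set x | _].
have mE : measurable E by exact: measurable_gt_mean_distance.
rewrite -[X in nu X]setIT -integral_indic//.
set b := kappa ^+ 2 * u ^- 2 * expR (- (u `^ p / kappa)).
have b0 : 0 <= b.
  by rewrite mulr_ge0 ?expR_ge0// mulr_ge0 ?invr_ge0 ?sqr_ge0.
apply: (@le_trans _ _ (\int[nu]_x (b%:E * (q x)%:E))%E).
  apply: ge0_le_integral => //=.
  - by apply/measurable_EFinP.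
  - by apply/measurable_EFinP/measurable_funM.
  - move=> x _; rewrite -EFinM lee_fin indicE.
    case: (boolP (x \in E)) => [|_]; last by rewrite mulr_ge0.
    rewrite inE /E/= => ug.
    have g0 : 0 < gam x by rewrite -(pmulr_rgt0 _ kappa0) (lt_trans u0).
    have -> : b * q x = (kappa * gam x / u) ^+ 2 *
        expR (gam x `^ p - u `^ p / kappa).
      by rewrite expRD /b /q !exprMn exprVn; ring.
    have h1 : 1 <= kappa * gam x / u by rewrite ler_pdivlMr// mul1r ltW.
    have h2 : 1 <= expR (gam x `^ p - u `^ p / kappa).
      rewrite -[leLHS]expR0 ler_expR subr_ge0.
      rewrite ler_pdivrMr// mulrC.
      apply: (@le_trans _ _ ((kappa * gam x) `^ p)).
        by apply: ge0_ler_powR; rewrite ?nnegrE ?ltW// (lt_trans u0).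
      rewrite (powRM _ (ltW kappa0) (ltW g0)) ler_wpM2r ?powR_ge0//.
      rewrite -[leRHS](powRr1 (ltW kappa0)).
      by rewrite ler_powR// ltW.
    apply: (@le_trans _ _ (1 * 1)); first by rewrite mulr1.
    by apply: ler_pM => //; rewrite exprn_ege1.
rewrite (ge0_integralZl_EFin)//; last 2 first.
  - by move=> x _; rewrite lee_fin.
  - exact/measurable_EFinP.
apply: (@le_trans _ _ (b%:E * K%:E)%E); first by rewrite lee_wpmul2l.
by rewrite -EFinM lee_fin /b le_eqVlt; apply/orP; left; apply/eqP; ring.
Qed.

End lipschitz_function.
End moment.
End one_variable.

(** * Couplings with an empirical measure *)

Definition image_measure d d' (T : measurableType d) (T' : measurableType d')
    (R : realType) (m : {measure set T -> \bar R}) (f : T -> T')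
    (mf : measurable_fun setT f) : {measure set T' -> \bar R} :=
  measure_function_pushforward__canonical__measure_function_Measure m mf.

Lemma ge0_integral_mrestr d (T : measurableType d) (R : realType)
    (m : {measure set T -> \bar R}) (D : set T) (mD : measurable D)
    (h : T -> \bar R) : measurable_fun setT h -> (forall x, 0 <= h x)%E ->
  (\int[mrestr m mD]_x h x = \int[m]_(x in D) h x)%E.
Proof.
move=> mh h0.
rewrite (@ge0_negligible_integral _ _ _ _ setT (~` D))//=; last 2 first.
- exact: measurableC.
- by rewrite /mrestr setICl measure0.
rewrite setTD setCK; apply: eq_measure_integral => A mA AD.
by rewrite /= /mrestr setIidl.
Qed.

Section gluing.
Local Open Scope ereal_scope.
Context (R : realType) d (T : measurableType d).

(** A decomposition of mu into n measures of mass 1/n tells where the mass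
    sitting at each sample point is sent, hence defines a coupling. *)
Lemma glue_coupling (n : nat) (z : nat -> T) (mu : {measure set T -> \bar R})
    (nu_ : nat -> {measure set T -> \bar R}) : (0 < n)%N ->
  (forall k, (k < n)%N -> nu_ k setT = (n%:R^-1)%:E) ->
  (forall B, measurable B -> \sum_(k < n) nu_ k B = mu B) ->
  exists lam : probability (T * T)%type R,
    (forall A, measurable A ->
       lam (A `*` setT) = (n%:R^-1)%:E * \sum_(k < n) \d_(z k) A /\
       lam (setT `*` A) = mu A) /\
    forall h : T * T -> \bar R, measurable_fun setT h -> (forall x, 0 <= h x) ->
      \int[lam]_x h x = \sum_(k < n) \int[nu_ k]_y h (z k, y).
Proof.
move=> n0 nuT nuB.
have mpair k : measurable_fun [set: T] (fun y => (z k, y)) by exact: measurable_fun_pair.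
pose mm k := image_measure (nu_ k) (mpair k).
have mmE k A : mm k A = nu_ k [set y | A (z k, y)] by [].
have lam1 : msum mm n setT = 1.
  rewrite /msum (eq_bigr (fun=> (n%:R^-1)%:E)); last first.
    by move=> k _; rewrite mmE -(nuT k)//; congr (nu_ k _); apply/seteqP.
  rewrite sumEFin sumr_const card_ord -[X in X%:E]mulr_natr mulVf//.
  by rewrite pnatr_eq0 -lt0n.
pose lam : probability (T * T)%type R :=
  HB.pack (msum mm n) (Measure_isProbability.Build _ _ _ (msum mm n) lam1).
exists lam; split => [A mA|h mh h0].
  split.
    rewrite /lam/= /msum ge0_sume_distrr//; apply: eq_bigr => k _.
    rewrite mmE diracE; case: (boolP (z k \in A)) => zA /=.
      rewrite mule1 -(nuT k)//; congr (nu_ k _); apply/seteqP; split=> //= y _.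
      by split => //; rewrite -inE.
    rewrite mule0 -(measure0 (nu_ k)); congr (nu_ k _); apply/seteqP; split=> //= y.
    by case=> zA' _; move: zA; rewrite notin_setE.
  rewrite -(nuB _ mA) /lam/= /msum; apply: eq_bigr => k _.
  rewrite mmE; congr (nu_ k _); apply/seteqP; split=> //= y; first by case.
rewrite /lam/= ge0_integral_measure_sum//; apply: eq_bigr => k _.
by rewrite ge0_integral_pushforward.
Qed.

Lemma point_coupling (n : nat) (x0 : T) (mu : probability T R) : (0 < n)%N ->
  exists lam : probability (T * T)%type R,
    (forall A, measurable A ->
       lam (A `*` setT) = (n%:R^-1)%:E * \sum_(k < n) \d_x0 A /\
       lam (setT `*` A) = mu A) /\
    forall h : T * T -> \bar R, measurable_fun setT h -> (forall x, 0 <= h x) ->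
      \int[lam]_x h x = \int[mu]_y h (x0, y).
Proof.
move=> n0.
have mpair : measurable_fun [set: T] (fun y => (x0, y)) by exact: measurable_fun_pair.
exists (distribution mu (to_mfun mpair)); split => [A mA|h mh h0].
  split => //=.
    rewrite /distribution/= /pushforward/= sumEFin sumr_const card_ord.
    rewrite -[X in _ * X%:E]mulr_natl -EFinM mulrA mulVf ?mul1r; last first.
      by rewrite pnatr_eq0 -lt0n.
    rewrite indicE; case: (boolP (x0 \in A)) => xA /=.
      transitivity (mu setT); last exact: probability_setT.
      congr (mu _); apply/seteqP; split=> //= y _.
      by split => //; rewrite -inE.
    transitivity (mu set0); last exact: measure0.
    congr (mu _); apply/seteqP; split=> //= y.
    by case=> zA' _; move: xA; rewrite notin_setE.
  by congr (mu _); apply/seteqP; split=> //= y; first by case.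
by rewrite ge0_integral_distribution.
Qed.

Context (dist : T -> T -> R) (dist_ge0 : forall x y, (0 <= dist x y)%R)
  (dist_triangle : forall x y z, (dist x z <= dist x y + dist y z)%R)
  (measurable_dist : measurable_fun setT (fun x : T * T => dist x.1 x.2))
  (measurable_point : forall x : T, measurable [set x]).

Let mdist_r x : measurable_fun setT (dist x).
Proof.
have mp : measurable_fun [set: T] (fun y => (x, y)) by exact: measurable_fun_pair.
exact: measurableT_comp measurable_dist mp.
Qed.

(** The coupling lam sends the mass at the sample point z'_k to a part of mu;
    this part is now attributed to z_k, at the additional cost
    dist (z_k, z'_k) by the triangle inequality.  When several sample points
    coincide, the mass sent from their common position is shared equally between
    them: m k counts the indices j with z'_j = z'_k. *)
Lemma transport_coupling (n : nat) (z z' : nat -> T)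
    (mu : {measure set T -> \bar R}) (lam : probability (T * T)%type R) :
  (0 < n)%N ->
  (forall A, measurable A ->
       lam (A `*` setT) = (n%:R^-1)%:E * \sum_(k < n) \d_(z' k) A /\
       lam (setT `*` A) = mu A) ->
  exists lam' : probability (T * T)%type R,
    (forall A, measurable A ->
       lam' (A `*` setT) = (n%:R^-1)%:E * \sum_(k < n) \d_(z k) A /\
       lam' (setT `*` A) = mu A) /\
    \int[lam']_x (dist x.1 x.2)%:E <=
      (n%:R^-1 * \sum_(k < n) dist (z k) (z' k))%:E +
      \int[lam]_x (dist x.1 x.2)%:E.
Proof.
move=> n0 marg.
pose m k : R := (\sum_(j < n) (z' j == z' k)%:R)%R.
have m_gt0 k : (k < n)%N -> (0 < m k)%R.
  move=> kn; rewrite /m (bigD1 (Ordinal kn))//= eqxx.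
  by rewrite ltr_pwDl// sumr_ge0.
pose D k := [set z' k] `*` [set: T].
have mD k : measurable (D k) by exact: measurableX.
have m_ge0 k : (0 <= (m k)^-1)%R by rewrite invr_ge0 sumr_ge0.
pose w k : {nonneg R} := NngNum (m_ge0 k).
have lamD k : lam (D k) = (n%:R^-1 * m k)%:E.
  rewrite (marg _ (measurable_point _)).1 EFinM; congr (_ * _).
  rewrite /m -sumEFin; apply: eq_bigr => j _.
  rewrite diracE; congr ((_ : bool)%:R%:E).
  by apply/idP/eqP => [/[!inE]//|->]; rewrite inE.
(* The weights of the indices sharing a given position sum to 1. *)
have average (h : T * T -> \bar R) : measurable_fun setT h ->
    (forall x, 0 <= h x) ->
    \sum_(k < n) (w k)%:num%:E * \int[lam]_(x in D k) h x = \int[lam]_x h x.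
  move=> mh h0.
  have mhD k : measurable_fun setT (h \_ (D k)).
    by apply/(measurable_restrictT _ (mD k)); exact: measurable_funTS.
  have hD0 k x : 0 <= (h \_ (D k)) x by exact: erestrict_ge0.
  transitivity (\int[lam]_x \sum_(k < n) ((w k)%:num%:E * (h \_ (D k)) x)).
    rewrite ge0_integral_sum//=.
    - apply: eq_bigr => k _; rewrite ge0_integralZl_EFin//.
      by rewrite [in LHS]integral_mkcond.
    - by move=> k; exact: measurable_funeM.
    - by move=> k x _; apply: mule_ge0 => //; rewrite lee_fin.
  pose S := [set x : T | exists2 k, (k < n)%N & x = z' k].
  have mS : measurable S.
    rewrite (_ : S = \bigcup_(k in `I_n) [set z' k]).
      exact: fin_bigcup_measurable.
    by apply/seteqP; split => [x [k kn ->]|x [k kn ->]]; exists k.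
  have lamS : lam (S `*` setT) = 1.
    rewrite (marg _ mS).1 (eq_bigr (fun=> 1)); last first.
      by move=> k _; rewrite diracE mem_set//; exists k.
    rewrite sumEFin sumr_const card_ord -EFinM mulVf//.
    by rewrite pnatr_eq0 -lt0n.
  apply: ge0_ae_eq_integral => //.
  - by apply: emeasurable_sum => k; exact: measurable_funeM.
  - by move=> x _; apply: sume_ge0 => k _; apply: mule_ge0 => //; rewrite lee_fin.
  exists (~` (S `*` setT)); split.
  - by apply: measurableC; exact: measurableX.
  - transitivity (1 - lam (S `*` setT)); last by rewrite lamS subee.
    by apply: probability_setC; exact: measurableX.
  move=> x /=; apply: contra_not => -[/= [i ni xi] _] _.
  rewrite (eq_bigr (fun k : 'I_n => ((m i)^-1 * (z' k == z' i)%:R)%:E * h x)).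
    rewrite -ge0_sume_distrl; last by move=> k _; rewrite lee_fin mulr_ge0.
    rewrite sumEFin -mulr_sumr mulVf ?mul1e// gt_eqF//; exact: m_gt0.
  move=> k _; rewrite patchE; case: eqVneq => [ki|ki].
    rewrite mem_set; last by split => //=; rewrite xi.
    by rewrite mulr1 /m ki.
  rewrite memNset ?mule0 ?mulr0 ?mul0e//.
  by case=> /= xk _; move/eqP: ki; rewrite -xk xi.
pose nu_ k : {measure set T -> \bar R} :=
  mscale (w k) (image_measure (mrestr lam (mD k)) measurable_snd).
have nuT k : (k < n)%N -> nu_ k setT = (n%:R^-1)%:E.
  move=> kn; rewrite /nu_/= /mscale/= /pushforward/= /mrestr preimage_setT setTI.
  by rewrite lamD -EFinM mulrCA mulVf ?mulr1// gt_eqF// m_gt0.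
have nuB B : measurable B -> \sum_(k < n) nu_ k B = mu B.
  move=> mB; rewrite -(marg _ mB).2.
  have mTB : measurable ([set: T] `*` B) by exact: measurableX.
  rewrite -[X in lam X]setIT -integral_indic// -average//; last first.
    exact/measurable_EFinP.
  apply: eq_bigr => k _; rewrite integral_indic//.
  congr (_ * lam (_ `&` _)); apply/seteqP; split => // -[x y]/=; tauto.
have [lam' [lam'marg lam'int]] := glue_coupling z n0 nuT nuB.
exists lam'; split => //.
have md : measurable_fun setT (fun x : T * T => (dist x.1 x.2)%:E).
  exact/measurable_EFinP.
rewrite (lam'int _ md); last by move=> x; rewrite lee_fin.
rewrite mulr_sumr -sumEFin -(average _ md); last by move=> x; rewrite lee_fin.
rewrite -big_split/=; apply: lee_sum => k _.
have mzk : measurable_fun setT (fun y => (dist (z k) y)%:E).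
  exact/measurable_EFinP.
rewrite /nu_ ge0_integral_mscale//; last by move=> x _; rewrite lee_fin.
rewrite ge0_integral_pushforward//; last by move=> x _; rewrite lee_fin.
rewrite preimage_setT ge0_integral_mrestr//; last first.
- by move=> x; rewrite lee_fin.
- exact: measurableT_comp mzk measurable_snd.
have -> : (n%:R^-1 * dist (z k) (z' k))%:E =
    (w k)%:num%:E * \int[lam]_(x in D k) (dist (z k) (z' k))%:E.
  have -> : \int[lam]_(x in D k) (dist (z k) (z' k))%:E =
      (dist (z k) (z' k))%:E * lam (D k) by exact: integral_cst.
  rewrite lamD -!EFinM; congr EFin.
  have mk : m k != 0%R by rewrite gt_eqF// m_gt0.
  have nn : (n%:R : R) != 0%R by rewrite pnatr_eq0 -lt0n.
  by rewrite /=; field; apply/andP.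
rewrite -ge0_muleDr; last 2 first.
- by apply: integral_ge0 => x _; rewrite lee_fin.
- by apply: integral_ge0 => x _; rewrite lee_fin.
apply: lee_wpmul2l; first by rewrite lee_fin.
rewrite -ge0_integralD//; last 2 first.
- by move=> x _; rewrite lee_fin.
- exact: measurable_funTS.
apply: ge0_le_integral => //.
- by move=> x _; rewrite lee_fin.
- by apply: measurable_funTS; exact: measurableT_comp mzk measurable_snd.
- by apply: emeasurable_funD => //; exact: measurable_funTS.
- by move=> x [/= <- _]; rewrite lee_fin dist_triangle.
by move=> x _; rewrite lee_fin.
Qed.
End gluing.

(** * First moment of an invariant law *)

Section invariant_moment.
Local Open Scope ereal_scope.
Context (R : realType) d d' (T : measurableType d) (S : measurableType d').
Context (F : T * S -> T) (mF : measurable_fun setT F).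
Context (nu : probability S R) (mu : probability T R).
Hypothesis inv : forall A, measurable A ->
  \int[mu]_x nu [set y | A (F (x, y))] = mu A.

(** The law mu is the image of mu x nu under F. *)
Lemma invariant_integral (h : T -> \bar R) :
  measurable_fun setT h -> (forall x, 0 <= h x) ->
  \int[mu]_x h x = \int[mu]_x \int[nu]_y h (F (x, y)).
Proof.
move=> mh h0.
have mhF : measurable_fun setT (h \o F) by exact: measurableT_comp.
have hF0 x : 0 <= (h \o F) x by exact: h0.
have <- := fubini_tonelli1 (m1 := mu) (m2 := nu) (h \o F) mhF hF0.
have <- : \int[pushforward (mu \x nu) F]_x h x = \int[mu \x nu]_z (h \o F) z.
  by rewrite ge0_integral_pushforward.
apply: (eq_measure_integral (image_measure (mu \x nu) mF)) => A mA _.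
transitivity (\int[mu]_x nu [set y | A (F (x, y))]); first exact/esym/inv.
apply: eq_integral => x _; congr (nu _).
by apply/seteqP; split => y; rewrite /xsection/= inE.
Qed.

(** The finiteness of the integral of g is not known in advance, so the drift
    inequality is applied to min(g, K), whose integral is finite.  By invariance
    and Jensen, int min(g, K) <= int min(rho g + c, K); moreover
    min(g, K) + c >= min(rho g + c, K) + (1 - rho) g on g <= K, and
    min(g, K) >= min(rho g + c, K) on g > K.  Hence the integral of g over g <= K
    is at most c / (1 - rho), uniformly in K. *)
Lemma invariant_moment (rho c : R) (g : T -> R) :
  (0 <= rho < 1)%R -> (0 <= c)%R ->
  measurable_fun setT g -> (forall x, 0 <= g x)%R ->
  (forall x, \int[nu]_y (g (F (x, y)))%:E <= (rho * g x + c)%:E) ->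
  \int[mu]_x (g x)%:E < +oo.
Proof.
move=> /andP[rho0 rho1] c0 mg g0 gF.
pose tr (K : nat) x := (g x * (g x <= K%:R)%R%:R)%R.
have mtr K : measurable_fun setT (tr K).
  apply: measurable_funM => //; apply: measurableT_comp => //.
  exact: measurable_fun_ler.
have trK K : \int[mu]_x (tr K x)%:E <= (c / (1 - rho))%:E.
  have mmin e (U : measurableType e) (f : U -> R) : measurable_fun setT f ->
      measurable_fun setT (fun x => (Num.min (f x) K%:R)%:E).
    by move=> mf; apply/measurable_EFinP/measurable_minr.
  have min0 (U : Type) (f : U -> R) : (forall x, 0 <= f x)%R ->
      forall x, 0 <= (Num.min (f x) K%:R)%:E.
    by move=> f0 x; rewrite lee_fin le_min f0/=.
  have Ifin (f : T -> R) : measurable_fun setT f -> (forall x, 0 <= f x)%R ->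
      \int[mu]_x (Num.min (f x) K%:R)%:E \is a fin_num.
    move=> mf f0; rewrite ge0_fin_numE; last by apply: integral_ge0 => x _; exact: min0.
    apply: (@le_lt_trans _ _ (\int[mu]_x (K%:R)%:E)).
      apply: ge0_le_integral => //; first by move=> x _; exact: min0.
      - exact: mmin.
      - by move=> x _; rewrite lee_fin ge_min lexx orbT.
    by rewrite integral_probability_cst ltry.
  have mlin : measurable_fun setT (fun x => rho * g x + c)%R.
    by apply: measurable_funD => //; apply: measurable_funM.
  have lin0 x : (0 <= rho * g x + c)%R by rewrite addr_ge0// mulr_ge0.
  have H1 : \int[mu]_x (Num.min (g x) K%:R)%:E <=
      \int[mu]_x (Num.min (rho * g x + c) K%:R)%:E.
    rewrite (invariant_integral (mmin _ _ _ mg) (min0 _ _ g0)).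
    have mgF x : measurable_fun setT (fun y => g (F (x, y))).
      apply: (measurableT_comp mg); apply: (measurableT_comp mF).
      exact: measurable_fun_pair.
    apply: ge0_le_integral => //.
    - by move=> x _; apply: integral_ge0 => y _; exact: min0.
    - apply: (measurable_fun_fubini_tonelli_F
        (fun z => (Num.min (g (F z)) K%:R)%:E)).
        apply/measurable_EFinP/measurable_minr => //.
        exact: (measurableT_comp mg mF).
      by move=> z; rewrite lee_fin le_min g0/=.
    - exact: mmin.
    move=> x _; rewrite EFin_min le_min; apply/andP; split.
      apply: le_trans (gF x); apply: ge0_le_integral => //.
      - by move=> y _; exact: (min0 _ (fun y => g (F (x, y))) (fun y => g0 _) y).
      - exact: mmin _ _ _ (mgF x).
      - exact/measurable_EFinP.
      - by move=> y _; rewrite lee_fin ge_min lexx.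
    rewrite -[leRHS](integral_probability_cst nu); apply: ge0_le_integral => //.
    - by move=> y _; exact: (min0 _ (fun y => g (F (x, y))) (fun y => g0 _) y).
    - exact: mmin _ _ _ (mgF x).
    - by move=> y _; rewrite lee_fin ge_min lexx orbT.
  have H2 : \int[mu]_x (Num.min (rho * g x + c) K%:R)%:E +
      (1 - rho)%:E * \int[mu]_x (tr K x)%:E <=
      \int[mu]_x (Num.min (g x) K%:R)%:E + c%:E.
    have tr0 x : (0 <= tr K x)%R by rewrite mulr_ge0.
    have r0 : (0 <= 1 - rho)%R by rewrite subr_ge0 ltW.
    rewrite -(integral_probability_cst mu c%:E) -ge0_integralZl_EFin//; last 2 first.
    - by move=> x _; rewrite lee_fin.
    - exact/measurable_EFinP.
    rewrite -ge0_integralD//; last 4 first.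
    - by move=> x _; exact: (min0 _ (fun x => rho * g x + c)%R lin0).
    - exact: mmin mlin.
    - by move=> x _; rewrite -EFinM lee_fin mulr_ge0.
    - by apply: measurable_funeM; exact/measurable_EFinP.
    rewrite -ge0_integralD//; last 2 first.
    - by move=> x _; exact: (min0 _ g g0).
    - exact: mmin mg.
    apply: ge0_le_integral => //.
    - by move=> x _; rewrite adde_ge0 ?(min0 _ (fun x => rho * g x + c)%R lin0)// -EFinM lee_fin mulr_ge0.
    - apply: emeasurable_funD; first exact: mmin mlin.
      by apply: measurable_funeM; exact/measurable_EFinP.
    - by apply: emeasurable_funD => //; exact: mmin mg.
    move=> x _; rewrite -EFinM -!EFinD lee_fin /tr.
    have m1 : (Num.min (rho * g x + c) K%:R <= rho * g x + c)%R.
      by rewrite ge_min lexx.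
    have m2 : (Num.min (rho * g x + c) K%:R <= K%:R)%R.
      by rewrite ge_min lexx orbT.
    by have [gK|gK] := leP (g x) K%:R; rewrite ?mulr1 ?mulr0; lra.
  have I_fin := Ifin _ mg g0.
  have H3 : (1 - rho)%:E * \int[mu]_x (tr K x)%:E <= c%:E.
    rewrite -(leeD2lE _ _ I_fin) (le_trans _ H2)//.
    by rewrite leeD2r.
  by rewrite EFinM lee_pdivlMr ?subr_gt0// muleC.
have mono x : nondecreasing_seq (fun K => (tr K x)%:E).
  move=> K K' KK'; rewrite lee_fin /tr ler_wpM2l// ler_nat.
  case: (leP (g x) K%:R) => // gK.
  by rewrite (le_trans gK)// ler_nat.
have tr0 K x : 0 <= (tr K x)%:E by rewrite lee_fin mulr_ge0.
have lim x : (tr K x)%:E @[K --> \oo] --> (g x)%:E.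
  apply: cvg_near_cst.
  exists (Num.truncn (g x)).+1 => // K /= gK.
  rewrite /tr (_ : g x <= K%:R)%R ?mulr1//.
  apply: ltW; apply: lt_le_trans (truncnS_gt _) _.
  by rewrite ler_nat.
have -> : \int[mu]_x (g x)%:E = \int[mu]_x limn (fun K => (tr K x)%:E).
  by apply: eq_integral => x _; apply/esym/cvg_lim.
rewrite monotone_convergence//; last first.
  by move=> K; exact/measurable_EFinP.
apply: (@le_lt_trans _ _ (c / (1 - rho))%:E); last exact: ltry.
apply: lime_le.
  apply: ereal_nondecreasing_is_cvgn => K K' KK'.
  apply: ge0_le_integral => //; [exact/measurable_EFinP|exact/measurable_EFinP|].
  by move=> x _; exact: mono.
by apply: nearW.
Qed.

(** Drift inequality for g = dT x0: going from x0 to F (x, y) through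
    F (x0, y0) and F (x0, y) costs a constant, a multiple of the distance of y
    to y0, and a distance which contracts in the mean. *)
Lemma invariant_first_moment (dT : T -> T -> R) (dS : S -> S -> R) (rho : R)
    (x0 : T) (y0 : S) :
  measurable_distance dT -> measurable_distance dS -> (0 <= rho < 1)%R ->
  (forall x y y', dT (F (x, y)) (F (x, y')) <= dS y y')%R ->
  (forall x x',
    \int[nu]_y (dT (F (x, y)) (F (x', y)))%:E <= (rho * dT x x')%:E) ->
  mean_distance nu dS y0 \is a fin_num ->
  \int[mu]_x (dT x0 x)%:E < +oo.
Proof.
move=> HT HS rho01 FS FT Gfin.
pose a := dT x0 (F (x0, y0)); pose G := fine (mean_distance nu dS y0).
have T0 x x' : (0 <= dT x x')%R by exact: distance_ge0 HT _ _.
have S0 y y' : (0 <= dS y y')%R by exact: distance_ge0 HS _ _.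
have G0 : (0 <= G)%R by rewrite fine_ge0// mean_distance_ge0.
have mFx x : measurable_fun setT (fun y => F (x, y)).
  by apply: (measurableT_comp mF); exact: measurable_fun_pair.
have mdT : measurable_fun setT (dT x0) by exact: measurable_distance_from HT x0.
apply: (@invariant_moment rho (a + G) (dT x0)) => //.
  by rewrite addr_ge0// T0.
move=> x.
have mdS : measurable_fun setT (fun y => (dS y0 y)%:E).
  by apply/measurable_EFinP; exact: measurable_distance_from HS y0.
have mdF : measurable_fun setT (fun y => (dT (F (x0, y)) (F (x, y)))%:E).
  by apply/measurable_EFinP; apply: (measurable_distance2 HT).
have E1 : \int[nu]_y ((dS y0 y)%:E + (dT (F (x0, y)) (F (x, y)))%:E) =
    G%:E + \int[nu]_y (dT (F (x0, y)) (F (x, y)))%:E.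
  rewrite /G (fineK Gfin); apply: ge0_integralD => // y _; rewrite lee_fin//.
have E2 : \int[nu]_y (a%:E + ((dS y0 y)%:E +
    (dT (F (x0, y)) (F (x, y)))%:E)) =
    a%:E + (G%:E + \int[nu]_y (dT (F (x0, y)) (F (x, y)))%:E).
  rewrite -E1 -[X in X + _](integral_probability_cst nu).
  apply: ge0_integralD => //; last exact: emeasurable_funD.
  - by move=> y _; rewrite lee_fin; exact: T0.
  - by move=> y _; rewrite adde_ge0// lee_fin.
apply: (@le_trans _ _ (a%:E + (G%:E + (rho * dT x0 x)%:E))); last first.
  by rewrite -!EFinD lee_fin; lra.
apply: (@le_trans _ _ (a%:E +
    (G%:E + \int[nu]_y (dT (F (x0, y)) (F (x, y)))%:E))); last first.
  by apply: leeD => //; apply: leeD.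
rewrite -E2; apply: ge0_le_integral => //.
- by move=> y _; rewrite lee_fin.
- by apply/measurable_EFinP; exact: (measurableT_comp mdT (mFx x)).
- by apply: emeasurable_funD => //; apply: emeasurable_funD.
move=> y _; rewrite -!EFinD lee_fin.
have h1 := distance_triangle HT x0 (F (x0, y0)) (F (x, y)).
have h2 := distance_triangle HT (F (x0, y0)) (F (x0, y)) (F (x, y)).
have h3 := FS x0 y0 y.
by rewrite /a; lra.
Qed.

End invariant_moment.

(** * The Wasserstein distance to an empirical measure *)

Section wasserstein_empirical.
Context (R : realType) (T : completeMetricType R) (sepT : separable T).

Lemma measurable_singleton (x : T) : measurable ([set x] : set (borel T)).
Proof.
rewrite (_ : [set x] = ~` [set y | 0 < mdist x y]).
  apply: measurableC; rewrite -[X in measurable X]setTI.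
  have -> : [set y | 0 < mdist x y] = mdist x @^-1` `]0, +oo[.
    by apply/seteqP; split => y /=; rewrite in_itv/= andbT.
  exact: measurable_mdistr.
apply/seteqP; split => [y ->|y] /=; first by rewrite mdistxx ltxx.
by rewrite mdist_gt0 => /negP; rewrite negbK => /eqP.
Qed.

Let measurable_dist2 : measurable_fun setT
  (fun z : borel T * borel T => mdist (z.1 : T) z.2).
Proof.
have := measurable_distance2 (measurable_distance_metric sepT ltr01)
  (@measurable_fst _ _ (borel T) (borel T)) (@measurable_snd _ _ (borel T) (borel T)).
by under eq_fun do rewrite mul1r.
Qed.

Context (n : nat) (n_gt0 : (0 < n)%N) (mu : probability (borel T) R).

Let W (z : nat -> T) := W1 (empirical n z) mu.

Lemma W1_ge0 z : (0 <= W z)%E.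
Proof.
apply: le_ereal_inf_tmp => _ [lam _ <-].
by apply: integral_ge0 => x _; rewrite lee_fin mdist_ge0.
Qed.

Lemma W1_empirical_le z z' :
  (W z <= (n%:R^-1 * \sum_(k < n) mdist (z k.+1) (z' k.+1))%:E + W z')%E.
Proof.
rewrite -leeBlDl//.
apply: le_ereal_inf_tmp => _ [lam marg <-].
rewrite leeBlDl//.
have [lam' [marg' cost]] := @transport_coupling R _ (borel T)
  (@mdist R T) (@mdist_ge0 R T) (@metric_triangle R T) measurable_dist2
  measurable_singleton n (fun k => z k.+1) (fun k => z' k.+1) mu lam n_gt0 marg.
apply: le_trans cost; apply: ereal_inf_lbound.
by exists lam'.
Qed.

Lemma W1_empirical_fin_num (x0 : T) z :
  (\int[mu]_y (mdist x0 y)%:E < +oo)%E -> W z \is a fin_num.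
Proof.
move=> mu_fin; rewrite ge0_fin_numE ?W1_ge0//.
apply: (le_lt_trans (W1_empirical_le z (fun=> x0))).
rewrite lte_add_pinfty ?ltry//.
have [lam [marg cost]] :=
  @point_coupling R _ (borel T) n (x0 : borel T) mu n_gt0.
apply: (@le_lt_trans _ _ (\int[lam]_x (mdist (x.1 : T) x.2)%:E)%E).
  by apply: ereal_inf_lbound; exists lam.
rewrite cost//; last by move=> x; rewrite lee_fin mdist_ge0.
exact/measurable_EFinP.
Qed.

(** A point of sample is z k.+1, as in [empirical]; the value is meaningful when
    the distance is finite, which [W1_empirical_fin_num] ensures. *)
Definition rW1 z : R := fine (W z).

Lemma rW1_lipschitz (x0 : T) : (\int[mu]_y (mdist x0 y)%:E < +oo)%E ->
  forall z z', `|rW1 z - rW1 z'| <=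
    n%:R^-1 * \sum_(k < n) mdist (z k.+1) (z' k.+1).
Proof.
move=> mu_fin z z'.
have fin := W1_empirical_fin_num _ mu_fin.
have h a b : rW1 a - rW1 b <= n%:R^-1 * \sum_(k < n) mdist (a k.+1) (b k.+1).
  rewrite lerBlDr -lee_fin EFinD /rW1 !fineK//; exact: W1_empirical_le.
rewrite ler_norml h andbT lerNl opprB (le_trans (h _ _))//.
by under eq_bigr do rewrite metric_sym.
Qed.

End wasserstein_empirical.

(** * Averaging out one innovation *)

Definition update (T : Type) (z : nat -> T) (k : nat) (v : T) : nat -> T :=
  fun i => if i == k then v else z i.

(** The state after x is F (x, y), where the innovation y has law nu.  The
    assumption 1 + kappa rho <= kappa on the constant kappa is what makes the
    class [lip] stable under [step]. *)
Section chain_step.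
Context (R : realType) d d' (T : measurableType d) (S : measurableType d').
Context (dT : T -> T -> R) (HT : measurable_distance dT).
Context (dS : S -> S -> R) (HS : measurable_distance dS).
Context (F : T * S -> T) (mF : measurable_fun setT F).
Context (nu : probability S R) (p : R) (p0 : 0 < p) (p1 : p < 1) (K : R).
Hypothesis moment : moment_bound nu dS p K.
Context (rho kappa : R) (kappa1 : 1 <= kappa) (kappaE : 1 + kappa * rho <= kappa).
Hypothesis FS : forall x y y', dT (F (x, y)) (F (x, y')) <= dS y y'.
Hypothesis FT : forall x x',
  (\int[nu]_y (dT (F (x, y)) (F (x', y)))%:E <= (rho * dT x x')%:E)%E.

(** A functional of the n + 1 first states: it has constant 1 in each of the n
    first ones, and constant kappa in the current state, through which it may
    depend on the whole future. *)
Definition lip (n : nat) (f : (nat -> T) -> R) :=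
  forall z z', `|f z - f z'| <=
    \sum_(i < n) dT (z i) (z' i) + kappa * dT (z n) (z' n).

Definition next (n : nat) (f : (nat -> T) -> R) (z : nat -> T) (y : S) : R :=
  f (update z n.+1 (F (z n, y))).

(** The conditional expectation of f given the n + 1 first states. *)
Definition step (n : nat) (f : (nat -> T) -> R) (z : nat -> T) : R :=
  \int[nu]_y next n f z y.

Let kappa0 : 0 < kappa. Proof. exact: lt_le_trans kappa1. Qed.

Lemma measurable_lip (n : nat) f e (U : measurableType e) (V : nat -> U -> T) :
  lip n f -> (forall i, (i <= n)%N -> measurable_fun setT (V i)) ->
  measurable_fun setT (fun w => f (V ^~ w)).
Proof.
move=> fL mV; apply: (distance_lipschitz HT (n := n.+1) (c := kappa)) => //.
- exact: ltW.
move=> z z'; rewrite (le_trans (fL z z'))// big_ord_recr/= mulrDr lerD2r.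
rewrite -[leLHS]mul1r ler_wpM2r//.
by apply: sumr_ge0 => i _; exact: distance_ge0 HT _ _.
Qed.

Lemma lipN n f : lip n f -> lip n (fun z => - f z).
Proof. by move=> fL z z'; rewrite -opprD normrN; exact: fL. Qed.

Section one_step.
Context (n : nat) (f : (nat -> T) -> R) (fL : lip n.+1 f).

Lemma next_lipschitz z y y' : `|next n f z y - next n f z y'| <= kappa * dS y y'.
Proof.
rewrite (le_trans (fL _ _))// big1 ?add0r; last first.
  move=> i _; by rewrite /update ltn_eqF ?(distance_xx HT).
by rewrite /update eqxx ler_wpM2l ?FS// ltW.
Qed.

Let inext z : nu.-integrable setT (fun y => (next n f z y)%:E).
Proof. exact: (integrable_lipschitz HS p0 moment kappa1 (next_lipschitz z)). Qed.

Let mdF x x' : measurable_fun setT (fun y => dT (F (x, y)) (F (x', y))).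
Proof.
by apply: (measurable_distance2 HT); apply: (measurableT_comp mF);
  exact: measurable_fun_pair.
Qed.

(** The last state z n.+1 = F (z n, y) moves in the mean by rho dT (z n, z' n),
    which adds kappa rho to the constant 1 of f in z n. *)
Lemma lip_step : lip n (step n f).
Proof.
move=> z z'.
rewrite /step -RintegralB//; [|exact: inext|exact: inext].
have inn : nu.-integrable setT
    (EFin \o (fun y => next n f z y - next n f z' y)).
  exact: (integrableB measurableT (inext z) (inext z')).
apply: (le_trans (le_normr_Rintegral _ inn)) => //.
set s := \sum_(i < n) dT (z i) (z' i).
have s0 : 0 <= s by apply: sumr_ge0 => i _; exact: distance_ge0 HT _ _.
have iFF : nu.-integrable setT (fun y => (dT (F (z n, y)) (F (z' n, y)))%:E).
  apply/integrableP; split; first exact/measurable_EFinP.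
  under eq_integral do rewrite gee0_abs ?lee_fin ?(distance_ge0 HT)//.
  by rewrite (le_lt_trans (FT _ _))// ltry.
have ir : nu.-integrable setT
    (fun y => (s + dT (z n) (z' n) + kappa * dT (F (z n, y)) (F (z' n, y)))%:E).
  exact: (integrableD measurableT (integrable_probability_cst nu _)
    (integrableZl measurableT kappa iFF)).
apply: (@le_trans _ _ (\int[nu]_y
    (s + dT (z n) (z' n) + kappa * dT (F (z n, y)) (F (z' n, y))))).
  apply: le_Rintegral => //; first exact: (integrable_norm inn).
  move=> y _; rewrite (le_trans (fL _ _))// big_ord_recr/=.
  rewrite /update eqxx lerD2r ltn_eqF//  lerD2r.
  by apply: ler_sum => i _; rewrite ltn_eqF// (ltn_trans (ltn_ord i)).
rewrite RintegralD//; last 2 first.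
- exact: (integrable_probability_cst nu).
- exact: (integrableZl measurableT kappa iFF).
rewrite Rintegral_cst//= probability_setT/= mulr1 RintegralZl//.
rewrite -addrA lerD2l.
have FT' : \int[nu]_y dT (F (z n, y)) (F (z' n, y)) <= rho * dT (z n) (z' n).
  rewrite -lee_fin fineK ?FT//; exact: integrable_fin_num.
apply: (@le_trans _ _ (dT (z n) (z' n) + kappa * (rho * dT (z n) (z' n)))).
  by rewrite lerD2l ler_wpM2l// ltW.
rewrite mulrA -[X in X + _]mul1r -mulrDl ler_wpM2r//.
exact: distance_ge0 HT _ _.
Qed.

Lemma next_laplace (u l : R) z : 0 < u -> 0 <= l ->
  l * u `^ (1 - p) <= kappa^-1 ->
  (\int[nu]_y (expR (l * Num.min (next n f z y - step n f z) u))%:E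
     <= (expR (l ^+ 2 * (kappa ^+ 2 * K)))%:E)%E.
Proof.
exact: (laplace_truncated HS p0 p1 moment kappa1 (next_lipschitz z)).
Qed.

Lemma next_deviation z y : `|next n f z y - step n f z| <=
  kappa * fine (mean_distance nu dS y).
Proof.
exact: (lipschitz_deviation HS p0 moment kappa1 (next_lipschitz z)).
Qed.

(** U is the past, with values in a space H on which the n + 1 first states z are
    measurable, and e is the next innovation, independent of it. *)
Section history.
Context d1 (H : measurableType d1) d2 (Om : measurableType d2).
Context (P : probability Om R) (U : Om -> H) (mU : measurable_fun setT U).
Context (e : Om -> S) (me : measurable_fun setT e).
Hypothesis Ue : forall A B, measurable A -> measurable B ->
  P (U @^-1` A `&` e @^-1` B) = (P (U @^-1` A) * nu B)%E.
Context (z : nat -> H -> T).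
Hypothesis mz : forall i, (i <= n)%N -> measurable_fun setT (z i).

Let mnext : measurable_fun setT
  (fun x : H * S => next n f (z ^~ x.1) x.2).
Proof.
apply: (measurable_lip (V := fun i (x : H * S) =>
  update (z ^~ x.1) n.+1 (F (z n x.1, x.2)) i) fL) => i.
rewrite leq_eqVlt => /predU1P[->|]; rewrite /update.
  rewrite eqxx; apply: (measurableT_comp mF).
  apply: measurable_fun_pair; last exact: measurable_snd.
  exact: (measurableT_comp (mz (leqnn n)) measurable_fst).
rewrite ltnS => ni; rewrite ltn_eqF//.
exact: (measurableT_comp (mz ni) measurable_fst).
Qed.

Let mstep : measurable_fun setT (fun h => step n f (z ^~ h)).
Proof. exact: (measurable_lip (V := z) lip_step mz). Qed.

(** The deviation of f from its conditional mean is at most kappa times the mean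
    distance of the innovation, which is integrable. *)
Lemma integrable_next :
  P.-integrable setT (fun w => (step n f (z ^~ (U w)))%:E) ->
  P.-integrable setT (fun w => (next n f (z ^~ (U w)) (e w))%:E).
Proof.
move=> istep.
have igam : nu.-integrable setT (fun y => (fine (mean_distance nu dS y))%:E).
  apply: (integrable_lipschitz HS p0 moment (lexx 1)) => x x'.
  by rewrite mul1r; exact: (mean_distance_lipschitz HS p0 moment).
have mgam : measurable_fun setT (fun y => fine (mean_distance nu dS y)).
  by apply/measurable_EFinP; exact: measurable_int igam.
have gam0 y : 0 <= fine (mean_distance nu dS y).
  by rewrite fine_ge0// mean_distance_ge0.
have igamP : P.-integrable setT
    (fun w => (fine (mean_distance nu dS (e w)))%:E).
  apply/integrableP; split.
    by apply/measurable_EFinP; exact: (measurableT_comp mgam me).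
  under eq_integral do rewrite gee0_abs ?lee_fin//.
  rewrite (independent_tonelli mU me Ue
    (g := fun x => (fine (mean_distance nu dS x.2))%:E)) /=; last 2 first.
  - by apply/measurable_EFinP; exact: (measurableT_comp mgam measurable_snd).
  - by move=> x; rewrite lee_fin.
  rewrite integral_probability_cst.
  case/integrableP : igam => _; apply: le_lt_trans.
  by under [leRHS]eq_integral do rewrite gee0_abs ?lee_fin//.
apply: (@le_integrable _ _ _ P setT measurableT _ (fun w =>
  (`|step n f (z ^~ (U w))| + kappa * fine (mean_distance nu dS (e w)))%:E)).
- apply/measurable_EFinP.
  exact: (measurableT_comp mnext (measurable_fun_pair mU me)).
- move=> w _; rewrite lee_fin [leRHS]ger0_norm; last first.
    by rewrite addr_ge0// mulr_ge0// ltW.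
  rewrite -lerBlDl (le_trans (lerB_dist _ _))//.
  exact: next_deviation.
- exact: (integrableD measurableT (integrable_norm istep)
    (integrableZl measurableT kappa igamP)).
Qed.

Lemma integral_next :
  P.-integrable setT (fun w => (step n f (z ^~ (U w)))%:E) ->
  (\int[P]_w (next n f (z ^~ (U w)) (e w))%:E =
   \int[P]_w (step n f (z ^~ (U w)))%:E)%E.
Proof.
move=> /integrable_next inx.
rewrite (independent_fubini mU me Ue
  (g := fun x => next n f (z ^~ x.1) x.2) mnext inx).
apply: eq_integral => w _; rewrite /step /Rintegral fineK//.
by apply: integrable_fin_num => //; exact: inext.
Qed.

(** The past L contributes a factor which is constant in the inner integral over
    the innovation; that integral is bounded by [next_laplace]. *)
Lemma laplace_next (L : H -> R) (u l : R) : measurable_fun setT L ->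
  0 < u -> 0 <= l -> l * u `^ (1 - p) <= kappa^-1 ->
  (\int[P]_w (expR (l * (L (U w) +
      Num.min (next n f (z ^~ (U w)) (e w) - step n f (z ^~ (U w))) u)))%:E
   <= (expR (l ^+ 2 * (kappa ^+ 2 * K)))%:E *
      \int[P]_w (expR (l * L (U w)))%:E)%E.
Proof.
move=> mL u0 l0 lu.
pose D (x : H * S) := Num.min
  (next n f (z ^~ x.1) x.2 - step n f (z ^~ x.1)) u.
have mD : measurable_fun setT D.
  apply: measurable_minr => //; apply: measurable_funB => //.
  exact: (measurableT_comp mstep measurable_fst).
have mexp d3 (V : measurableType d3) (g : V -> R) :
    measurable_fun setT g -> measurable_fun setT (fun x => (expR (l * g x))%:E).
  move=> mg; apply/measurable_EFinP; apply: measurableT_comp => //.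
  exact: measurable_funM.
rewrite (independent_tonelli mU me Ue
  (g := fun x => (expR (l * (L x.1 + D x)))%:E)) /=; last 2 first.
- apply: (mexp _ _ (fun x => L x.1 + D x)); apply: measurable_funD => //.
  exact: (measurableT_comp mL measurable_fst).
- by move=> x; rewrite lee_fin expR_ge0.
have mLU : measurable_fun setT (fun w => (expR (l * L (U w)))%:E).
  exact: (mexp _ _ _ (measurableT_comp mL mU)).
rewrite -ge0_integralZl_EFin ?expR_ge0//.
apply: ge0_le_integral => //.
- by move=> w _; apply: integral_ge0 => y _; rewrite lee_fin expR_ge0.
- apply: (measurableT_comp (measurable_fun_fubini_tonelli_F
    (m2 := nu) (fun x => (expR (l * (L x.1 + D x)))%:E) _ _) mU).
    apply: (mexp _ _ (fun x => L x.1 + D x)); apply: measurable_funD => //.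
    exact: (measurableT_comp mL measurable_fst).
  by move=> x; rewrite lee_fin expR_ge0.
- exact: measurable_funeM.
move=> w _.
have mDw : measurable_fun setT (fun y => (expR (l * D (U w, y)))%:E).
  apply: (mexp _ _ (fun y => D (U w, y))).
  by apply: (measurableT_comp mD); exact: measurable_fun_pair.
under eq_integral do rewrite mulrDr expRD EFinM.
rewrite ge0_integralZl_EFin ?expR_ge0// muleC lee_wpmul2r ?lee_fin ?expR_ge0//.
exact: (next_laplace (z ^~ (U w)) u0 l0 lu).
Qed.

End history.
End one_step.
End chain_step.

(** * Deviation inequality along the chain *)

(** Twice the sum of a union bound for N variables exceeding the level u and of a
    Chernoff bound with parameter l for the truncated sum exceeding t. *)
Definition deviation_bound (R : realType) (p kappa V N u l t : R) : R :=
  2 * (N * (V * u ^- 2 * expR (- (u `^ p / kappa))) +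
       expR (N * (l ^+ 2 * V) - l * t)).

Section chain.
Context (R : realType) d d' (T : measurableType d) (S : measurableType d').
Context (dT : T -> T -> R) (HT : measurable_distance dT).
Context (dS : S -> S -> R) (HS : measurable_distance dS).
Context (F : T * S -> T) (mF : measurable_fun setT F).
Context (nu : probability S R) (p : R) (p0 : 0 < p) (p1 : p < 1) (K : R).
Hypothesis moment : moment_bound nu dS p K.
Context (rho kappa : R) (kappa1 : 1 <= kappa) (kappaE : 1 + kappa * rho <= kappa).
Hypothesis FS : forall x y y', dT (F (x, y)) (F (x, y')) <= dS y y'.
Hypothesis FT : forall x x',
  (\int[nu]_y (dT (F (x, y)) (F (x', y)))%:E <= (rho * dT x x')%:E)%E.

Context (mu0 : probability T R).
Hypothesis moment0 : moment_bound mu0 dT p K.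

Context d0 (Om : measurableType d0) (P : probability Om R).
Context (Z : nat -> Om -> T) (e : nat -> Om -> S).
Hypothesis Z0_law : forall A, measurable A -> P (Z 0%N @^-1` A) = mu0 A.
Hypothesis ZS : forall k w, Z k.+1 w = F (Z k w, e k.+1 w).
(** hist n generates the events known after the innovation e n, and
    [g_sigma_algebraType (hist n)] is the sample space equipped with them. *)
Context (hist : nat -> set (set Om)).
Notation H n := (g_sigma_algebraType (hist n)).
Hypothesis hist_sub : forall n, hist n `<=` measurable.
Hypothesis hist_mono : forall n, hist n `<=` hist n.+1.
Hypothesis hist_Z0 : forall A, measurable A -> hist 0%N (Z 0%N @^-1` A).
Hypothesis hist_e : forall n A, measurable A -> hist n.+1 (e n.+1 @^-1` A).
Hypothesis hist_indep : forall n B A, <<s hist n >> B -> measurable A ->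
  P (B `&` e n.+1 @^-1` A) = (P B * nu A)%E.

Lemma measurable_from_hist n : measurable_fun setT (id : Om -> H n).
Proof.
move=> _ A; rewrite setTI preimage_id; move: A; apply: smallest_sub => //.
exact: sigma_algebra_measurable.
Qed.

Lemma measurable_hist_mono n : measurable_fun setT (id : H n.+1 -> H n).
Proof.
move=> _ A; rewrite setTI preimage_id; exact: (sub_sigma_algebra2 (@hist_mono n)).
Qed.

Lemma measurable_hist_Z n i : (i <= n)%N ->
  measurable_fun setT (Z i : H n -> T).
Proof.
elim: n i => [|n IH] i.
  rewrite leqn0 => /eqP -> _ A mA; rewrite setTI.
  by apply: sub_sigma_algebra; exact: hist_Z0.
rewrite leq_eqVlt => /predU1P[->|]; last first.
  rewrite ltnS => /IH mZ.
  exact: (measurableT_comp mZ (measurable_hist_mono (n := n))).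
have -> : Z n.+1 = fun w => F (Z n w, e n.+1 w) by apply/funext => w; exact: ZS.
apply: (measurableT_comp mF); apply: measurable_fun_pair.
  exact: (measurableT_comp (IH n (leqnn n)) (measurable_hist_mono (n := n))).
by move=> _ A mA; rewrite setTI; apply: sub_sigma_algebra; exact: hist_e.
Qed.

Let me n : measurable_fun setT (e n.+1).
Proof.
by move=> _ A mA; rewrite setTI; apply: (@hist_sub n.+1); exact: hist_e.
Qed.

Let mZ0 : measurable_fun setT (Z 0%N).
Proof.
by move=> _ A mA; rewrite setTI; apply: (@hist_sub 0%N); exact: hist_Z0.
Qed.

Let e_law n A : measurable A -> P (e n.+1 @^-1` A) = nu A.
Proof.
move=> mA; have := @hist_indep n setT A _ mA; rewrite setTI => ->.
  by rewrite probability_setT mul1e.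
exact: (@measurableT _ (H n)).
Qed.

(* Along the chain, [next] merely reads the true next state. *)
Let nextE n (f : (nat -> T) -> R) w : next F n f (Z ^~ w) (e n.+1 w) = f (Z ^~ w).
Proof.
rewrite /next -ZS; congr f; apply/funext => i; rewrite /update.
by case: eqP => [->|].
Qed.

(** Induction on n: f splits into its conditional mean, a functional of one state
    less, and a martingale difference.  L is the sum of the differences truncated
    at u; its Laplace transform gains a factor exp(l^2 V) at each step, and L
    dominates f - E f as long as no difference is affected by the truncation.
    Measurability of L with respect to the past is what allows the next step. *)
Lemma chain_laplace (n : nat) (f : (nat -> T) -> R) : lip dT kappa n f ->
  P.-integrable setT (fun w => (f (Z ^~ w))%:E) /\
  forall u : R, 0 < u -> exists L : Om -> R,
    [/\ measurable_fun setT (L : H n -> R),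
        forall l : R, 0 <= l -> l * u `^ (1 - p) <= kappa^-1 ->
          (\int[P]_w (expR (l * L w))%:E <=
             (expR (n.+1%:R * (l ^+ 2 * (kappa ^+ 2 * K))))%:E)%E &
        forall w, kappa * fine (mean_distance mu0 dT (Z 0%N w)) <= u ->
          (forall k, (k < n)%N ->
             kappa * fine (mean_distance nu dS (e k.+1 w)) <= u) ->
          f (Z ^~ w) - \int[P]_w f (Z ^~ w) <= L w].
Proof.
elim: n f => [|n IH] f fL.
  pose g x := f (fun=> x).
  have gZ w : f (Z ^~ w) = g (Z 0%N w).
    apply/eqP; rewrite -subr_eq0 -normr_le0 (le_trans (fL _ _))//.
    by rewrite big_ord0 add0r (distance_xx HT) mulr0.
  have gL x x' : `|g x - g x'| <= kappa * dT x x'.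
    by have := fL (fun=> x) (fun=> x'); rewrite big_ord0 add0r.
  have ig := integrable_lipschitz HT p0 moment0 kappa1 gL.
  have mg := measurable_int _ ig.
  have igP := integrable_law mZ0 Z0_law ig.
  have Eg : \int[P]_w f (Z ^~ w) = \int[mu0]_x g x.
    rewrite /Rintegral -(integral_law mZ0 Z0_law ig).
    by congr fine; apply: eq_integral => w _; rewrite gZ.
  split; first by under eq_fun do rewrite gZ.
  move=> u u0; pose D x := Num.min (g x - \int[mu0]_x g x) u.
  have mD : measurable_fun setT D.
    by apply: measurable_minr => //; apply: measurable_funB => //; exact/measurable_EFinP.
  exists (fun w => D (Z 0%N w)); split.
  - exact: (measurableT_comp mD (measurable_hist_Z (leqnn 0))).
  - move=> l l0 lu; rewrite mul1r.
    rewrite (ge0_integral_law mZ0 Z0_law (h := fun x => (expR (l * D x))%:E)).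
    + exact: (laplace_truncated HT p0 p1 moment0 kappa1 gL).
    + apply/measurable_EFinP; apply: measurableT_comp => //.
      exact: measurable_funM.
    + by move=> x; rewrite lee_fin expR_ge0.
  - move=> w Z0u _; rewrite gZ Eg /D le_min lexx/=.
    rewrite (le_trans (ler_norm _))// (le_trans _ Z0u)//.
    exact: (lipschitz_deviation HT p0 moment0 kappa1 gL).
have hL := lip_step HT HS mF p0 moment kappa1 kappaE FS FT fL.
have [ih IHu] := IH _ hL.
have Ue A B : measurable A -> measurable B ->
    P ((id : Om -> H n) @^-1` A `&` e n.+1 @^-1` B) = (P (id @^-1` A) * nu B)%E.
  by move=> mA mB; rewrite preimage_id hist_indep.
have mUn := @measurable_from_hist n.
have mZn : forall i, (i <= n)%N -> measurable_fun setT (Z i : H n -> T).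
  exact: measurable_hist_Z.
have inx := integrable_next HT HS mF p0 moment kappa1 FS fL mUn (me n) Ue mZn ih.
have Enx := integral_next HT HS mF p0 moment kappa1 FS fL mUn (me n) Ue mZn ih.
split; first by move: inx; under eq_fun do rewrite nextE.
have Ef : \int[P]_w f (Z ^~ w) = \int[P]_w step F nu n f (Z ^~ w).
  rewrite /Rintegral -Enx; congr fine.
  by apply: eq_integral => w _; rewrite nextE.
move=> u u0; have [L [mL EL LP]] := IHu u u0.
exists (fun w => L w + Num.min (f (Z ^~ w) - step F nu n f (Z ^~ w)) u).
split.
- apply: measurable_funD.
    exact: (measurableT_comp mL (measurable_hist_mono (n := n))).
  apply: measurable_minr => //; apply: measurable_funB.
    exact: (measurable_lip HT kappa1 fL (@measurable_hist_Z n.+1)).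
  apply: (measurable_lip HT kappa1 hL (V := fun i (w : H n.+1) => Z i w)) => i ni.
  by apply: measurable_hist_Z; rewrite (leq_trans ni).
- move=> l l0 lu.
  have := laplace_next HT HS mF p0 p1 moment kappa1 kappaE FS FT fL mUn (me n) Ue mZn
    mL u0 l0 lu.
  under eq_integral do rewrite nextE.
  move=> /le_trans; apply.
  apply: (@le_trans _ _ ((expR (l ^+ 2 * (kappa ^+ 2 * K)))%:E *
    (expR (n.+1%:R * (l ^+ 2 * (kappa ^+ 2 * K))))%:E)%E).
    by rewrite lee_wpmul2l ?lee_fin ?expR_ge0//; exact: EL.
  by rewrite -EFinM -expRD -[n.+2]add1n natrD mulrDl mul1r.
- move=> w Z0u eu; rewrite Ef.
  rewrite -(subrKA (step F nu n f (Z ^~ w))) addrC.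
  apply: lerD.
    by apply: LP => // k kn; apply: eu; rewrite (ltn_trans kn).
  rewrite le_min lexx/= (le_trans (ler_norm _))// (le_trans _ (eu n _))//.
  rewrite -(nextE n f w).
  exact: (next_deviation HT HS p0 moment kappa1 FS fL).
Qed.

Let V := kappa ^+ 2 * K.

(** Either some kappa G exceeds u, or L > t. *)
Lemma chain_deviation (n : nat) (f : (nat -> T) -> R) (u l t : R) :
  lip dT kappa n f -> 0 < u -> 0 <= l -> l * u `^ (1 - p) <= kappa^-1 ->
  (P [set w | (t < f (Z ^~ w) - \int[P]_w' f (Z ^~ w'))%R] <=
   (n.+1%:R * (V * u ^- 2 * expR (- (u `^ p / kappa))) +
    expR (n.+1%:R * (l ^+ 2 * V) - l * t))%:E)%E.
Proof.
move=> fL u0 l0 lu.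
have [iZ /(_ u u0)[L [mL EL LP]]] := chain_laplace fL.
have mLP : measurable_fun setT L.
  exact: (measurableT_comp mL (@measurable_from_hist n)).
pose B k : set Om := if k is k'.+1
  then e k'.+1 @^-1` [set y | (u < kappa * fine (mean_distance nu dS y))%R]
  else Z 0%N @^-1` [set x | (u < kappa * fine (mean_distance mu0 dT x))%R].
have mB k : measurable (B k).
  case: k => [|k]; rewrite -[B _]setTI.
    by apply: mZ0 => //; exact: (measurable_gt_mean_distance HT p0 moment0).
  by apply: me => //; exact: (measurable_gt_mean_distance HS p0 moment).
have PB k : (P (B k) <= (V * u ^- 2 * expR (- (u `^ p / kappa)))%:E)%E.
  case: k => [|k] /=.
    rewrite Z0_law; last exact: (measurable_gt_mean_distance HT p0 moment0).
    exact: (mean_distance_tail HT p0 p1 moment0 kappa1 u0).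
  rewrite e_law; last exact: (measurable_gt_mean_distance HS p0 moment).
  exact: (mean_distance_tail HS p0 p1 moment kappa1 u0).
pose E := [set w | (t < L w)%R].
have mE : measurable E.
  rewrite -[E]setTI (_ : E = L @^-1` `]t, +oo[); first exact: mLP.
  by apply/seteqP; split => w /=; rewrite in_itv/= andbT.
have PE : (P E <= (expR (n.+1%:R * (l ^+ 2 * V) - l * t))%:E)%E.
  rewrite -[X in P X]setIT -integral_indic//.
  have mexp : measurable_fun setT (fun w => (expR (l * L w))%:E).
    apply/measurable_EFinP; apply: measurableT_comp => //.
    exact: measurable_funM.
  apply: (@le_trans _ _ (\int[P]_w ((expR (- (l * t)))%:E * (expR (l * L w))%:E))%E).
    apply: ge0_le_integral => //=.
    - exact/measurable_EFinP.
    - exact: measurable_funeM.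
    move=> w _; rewrite -EFinM lee_fin -expRD indicE.
    case: (boolP (w \in E)) => [|_]; last exact: expR_ge0.
    rewrite inE /E/= => tL; rewrite -[leLHS]expR0 ler_expR addrC subr_ge0.
    by rewrite ler_wpM2l// ltW.
  rewrite ge0_integralZl_EFin ?expR_ge0// addrC expRD EFinM.
  by rewrite lee_wpmul2l ?lee_fin ?expR_ge0//; exact: EL.
pose U := \big[setU/set0]_(k < n.+1) B k.
have mU : measurable U by apply: bigsetU_measurable => k _; exact: mB.
have mfZ : measurable [set w | (t < f (Z ^~ w) - \int[P]_w' f (Z ^~ w'))%R].
  have mf : measurable_fun setT (fun w => f (Z ^~ w) - \int[P]_w' f (Z ^~ w')).
    apply: measurable_funB => //.
    by apply/measurable_EFinP; exact: measurable_int iZ.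
  rewrite -[X in measurable X]setTI (_ : [set w | _] =
    (fun w => f (Z ^~ w) - \int[P]_w' f (Z ^~ w')) @^-1` `]t, +oo[).
    exact: mf.
  by apply/seteqP; split => w /=; rewrite in_itv/= andbT.
apply: (@le_trans _ _ (P (U `|` E))).
  apply: le_measure; rewrite ?inE//; first exact: measurableU.
  move=> w /= tf; have [Uw|Uw] := pselect (U w); [by left|right].
  rewrite /E/=; apply: (lt_le_trans tf); apply: LP => [|k kn].
    rewrite leNgt; apply/negP => uZ; apply: Uw.
    by rewrite /U -bigcup_mkord; exists 0%N.
  rewrite leNgt; apply/negP => uZ; apply: Uw.
  by rewrite /U -bigcup_mkord; exists k.+1.
apply: (le_trans (measureU2 _ mU mE)).
rewrite EFinD; apply: leeD => //.
apply: (@le_trans _ _ (\sum_(k < n.+1) P (B k))%E).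
  exact: Boole_inequality.
apply: (@le_trans _ _
  (\sum_(k < n.+1) (V * u ^- 2 * expR (- (u `^ p / kappa)))%:E)%E).
  by apply: lee_sum => k _; exact: PB.
by rewrite sumEFin sumr_const card_ord mulr_natl.
Qed.

(** [lip] is stable under opposite. *)
Lemma chain_deviation_abs (n : nat) (f : (nat -> T) -> R) :
  lip dT kappa n f ->
  P.-integrable setT (fun w => (f (Z ^~ w))%:E) /\
  forall u l t : R, 0 < u -> 0 <= l -> l * u `^ (1 - p) <= kappa^-1 ->
  (P [set w | (t < `|f (Z ^~ w) - \int[P]_w' f (Z ^~ w')|)%R] <=
   (deviation_bound p kappa V n.+1%:R u l t)%:E)%E.
Proof.
move=> fL; have [iZ _] := chain_laplace fL.
split => // u l t u0 l0 lu.
have h1 := chain_deviation t fL u0 l0 lu.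
have h2 := chain_deviation t (lipN fL) u0 l0 lu.
have mf : measurable_fun setT (fun w => f (Z ^~ w) - \int[P]_w' f (Z ^~ w')).
  apply: measurable_funB => //.
  by apply/measurable_EFinP; exact: measurable_int iZ.
have EN : \int[P]_w' - f (Z ^~ w') = - \int[P]_w' f (Z ^~ w').
  rewrite -[RHS]mulN1r -RintegralZl//; congr fine.
  by apply: eq_integral => w _; rewrite mulN1r.
rewrite EN in h2.
rewrite /deviation_bound mulrDl mul1r EFinD.
apply: le_trans (leeD h1 h2).
pose D w := f (Z ^~ w) - \int[P]_w' f (Z ^~ w').
have mD (A : set R) : measurable A -> measurable (D @^-1` A).
  by move=> mA; rewrite -[X in measurable X]setTI; exact: mf.
rewrite (_ : [set w | _] = (D @^-1` `]t, +oo[) `|` (D @^-1` `]-oo, - t[)); last first.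
  apply/seteqP; split => w /=; rewrite !in_itv/= andbT lter_normr -/(D w).
    by move=> /orP[?|]; [left|rewrite ltrNr; right].
  by move=> [->//|]; rewrite ltrNr => ->; rewrite orbT.
apply: (le_trans (measureU2 _ _ _)); [exact: mD|exact: mD|].
rewrite le_eqVlt; apply/orP; left; apply/eqP; congr (_ + _)%E; congr (P _).
  by apply/seteqP; split => w /=; rewrite in_itv/= andbT.
by apply/seteqP; split => w /=; rewrite in_itv/= /D -opprD ltrNr.
Qed.

End chain.

(** * The history of the chain and its independence from the next innovation *)

Section history_algebra.
Local Open Scope ereal_scope.
Context (R : realType) d (Om : measurableType d) (P : probability Om R).
Context d1 (T : measurableType d1) d2 (S : measurableType d2).
Context (X1 : {RV P >-> T}) (eps : nat -> {RV P >-> S}).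
Hypothesis eps_indep : mutually_independent [set i | (1 <= i)%N] eps.
Hypothesis X1_indep : independent_of_family X1 [set i | (2 <= i)%N] eps.

Definition cylinder (A0 : set T) (A : nat -> set S) (n : nat) : set Om :=
  X1 @^-1` A0 `&` \bigcap_(i in [set i | (2 <= i < n.+2)%N]) (eps i @^-1` A i).

(** The cylinders form a pi-system, on which independence can be read off the
    product formula. *)
Definition history (n : nat) : set (set Om) :=
  [set B | exists A0 A, [/\ measurable A0, forall i, measurable (A i) &
    B = cylinder A0 A n]].

Lemma measurable_preimage_RV d' (U : measurableType d') (V : {RV P >-> U}) A :
  measurable A -> measurable (V @^-1` A).
Proof. by move=> mA; rewrite -[X in measurable X]setTI; exact: measurable_funP. Qed.

Lemma measurable_innovations A n : (forall i, measurable (A i)) ->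
  measurable (\bigcap_(i in [set i | (2 <= i < n.+2)%N]) (eps i @^-1` A i)).
Proof.
move=> mA; apply: bigcap_measurableType => i _.
exact: measurable_preimage_RV.
Qed.

Lemma history_sub n : history n `<=` measurable.
Proof.
move=> _ [A0 [A [mA0 mA ->]]]; apply: measurableI.
  exact: measurable_preimage_RV.
exact: measurable_innovations.
Qed.

Lemma history_setT n : history n setT.
Proof.
exists setT, (fun=> setT); split => //.
by apply/seteqP; split.
Qed.

Lemma history_mono n : history n `<=` history n.+1.
Proof.
move=> _ [A0 [A [mA0 mA ->]]].
exists A0, (fun i => if (i < n.+2)%N then A i else setT); split => //.
  by move=> i; case: ifP.
congr (_ `&` _); apply/seteqP; split => w Aw i /= /andP[i2 ni].
  by case: ifP => // ni'; apply: Aw; rewrite /= i2.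
by have := Aw i; rewrite /= i2 ni ltnW//; exact.
Qed.

Lemma history_X1 A : measurable A -> history 0 (X1 @^-1` A).
Proof.
move=> mA; exists A, (fun=> setT); split => //.
by apply/seteqP; split => w //= [].
Qed.

Lemma history_eps n A : measurable A -> history n.+1 (eps n.+2 @^-1` A).
Proof.
move=> mA; exists setT, (fun i => if i == n.+2 then A else setT); split => //.
  by move=> i; case: ifP.
apply/seteqP; split => w /=.
  by move=> wA; split => // i _ /=; case: eqP => // ->.
move=> [_ /(_ n.+2)]; rewrite eqxx; apply.
by rewrite /= ltnS leqnn.
Qed.

Lemma history_setI n : setI_closed (history n).
Proof.
move=> _ _ [A0 [A [mA0 mA ->]]] [B0 [B [mB0 mB ->]]].
exists (A0 `&` B0), (fun i => A i `&` B i); split.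
- exact: measurableI.
- by move=> i; exact: measurableI.
rewrite /cylinder setIACA bigcapI; congr (_ `&` _).
Qed.

Lemma cylinder_prob A0 A n : measurable A0 -> (forall i, measurable (A i)) ->
  P (cylinder A0 A n) = P (X1 @^-1` A0) * \prod_(i <- iota 2 n) P (eps i @^-1` A i).
Proof.
move=> mA0 mA; rewrite -eps_indep ?iota_uniq//; last first.
  by move=> i /=; rewrite mem_iota => /andP[/ltnW].
have -> : [set` iota 2 n] = [set i | (2 <= i < n.+2)%N].
  by apply/seteqP; split => i /=; rewrite mem_iota add2n.
apply: X1_indep => //.
pose GT := g_sigma_algebraType
  (\bigcup_(i in [set i | (2 <= i)%N]) g_sigma_algebra_preimage (eps i)).
apply: (@bigcap_measurableType _ GT) => i /= /andP[i2 _].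
apply: sub_sigma_algebra; exists i => //.
by exists (A i) => //; rewrite setTI.
Qed.

(** Two finite measures that agree on the pi-system of cylinders agree on the
    generated sigma-algebra: the restriction of P to the event on the innovation,
    and the multiple of P by its probability. *)
Lemma history_independent n B A : <<s history n >> B -> measurable A ->
  P (B `&` eps n.+2 @^-1` A) = P B * distribution P (eps n.+2) A.
Proof.
move=> hB mA.
have mE : measurable (eps n.+2 @^-1` A) by exact: measurable_preimage_RV.
have q0 : (0 <= fine (P (eps n.+2 @^-1` A)))%R by rewrite fine_ge0.
have qE : (fine (P (eps n.+2 @^-1` A)))%:E = P (eps n.+2 @^-1` A).
  by rewrite fineK// fin_num_measure.
rewrite muleC -[distribution _ _ _]qE.
apply: (@g_sigma_algebra_measure_unique _ _ _ (history n) (@history_sub n)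
  (fun=> setT) _ _ (mrestr P mE) (mscale (NngNum q0) P)) => //.
- by move=> _; exact: history_setT.
- by rewrite bigcup_const.
- exact: history_setI.
- move=> _ [A0 [A' [mA0 mA' ->]]] /=; rewrite /mrestr /mscale/= qE.
  pose A'' i := if i == n.+2 then A else A' i.
  have mA'' i : measurable (A'' i) by rewrite /A''; case: ifP.
  have -> : cylinder A0 A' n `&` eps n.+2 @^-1` A = cylinder A0 A'' n.+1.
    rewrite /cylinder -setIA; congr (_ `&` _); rewrite /A''.
    apply/seteqP; split => w /=.
      move=> [Aw wA] i /= /andP[i2]; rewrite ltnS leq_eqVlt => /predU1P[->|ni].
        by rewrite eqxx.
      by rewrite ltn_eqF//; apply: Aw; rewrite /= i2.
    move=> Aw; split.
      move=> i /= /andP[i2 ni]; have := Aw i.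
      by rewrite /= i2 ltnS ltnW// ltn_eqF//; exact.
    by have := Aw n.+2; rewrite /= ltnS leqnn eqxx; exact.
  have iotaS : iota 2 n.+1 = iota 2 n ++ [:: n.+2] by rewrite -[in LHS](addn1 n) iotaD add2n.
  rewrite !cylinder_prob// iotaS big_cat/= big_seq1 /A'' eqxx.
  rewrite muleA [RHS]muleC; congr (_ * _ * _).
  rewrite !big_seq; apply: eq_bigr => i; rewrite mem_iota => /andP[_ ni].
  by rewrite ltn_eqF.
- by move=> _; rewrite /= /mrestr setTI; rewrite -qE ltry.
Qed.

End history_algebra.

(** * Choice of the truncation level *)

Section rates.
Context (R : realType) (p kappa V : R).
Context (p0 : 0 < p) (p1 : p < 1) (kappa1 : 1 <= kappa) (V0 : 0 < V).

Let c := (kappa + 2 * V)^-1.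

Let kappa0 : 0 < kappa. Proof. exact: lt_le_trans kappa1. Qed.
Let d0 : 0 < kappa + 2 * V. Proof. by rewrite addr_gt0// mulr_gt0. Qed.
Let c0 : 0 < c. Proof. by rewrite invr_gt0. Qed.
Let ck : c <= kappa^-1.
Proof. by rewrite lef_pV2 ?posrE// lerDl mulr_ge0// ltW. Qed.
Let cV : c * V <= 2^-1.
Proof. by rewrite mulrC ler_pdivrMr//; have := kappa0; lra. Qed.

(** N <= u^(2-p) <= u^2 absorbs the number of variables in the union bound; a is
    the quantity in the exponent of the final estimate. *)
Lemma deviation_bound_le (N u l t a : R) : 0 <= N -> 1 <= u -> N <= u `^ (2 - p) ->
  0 <= a -> a <= u `^ p -> N * (l ^+ 2 * V) - l * t <= - (c / 2 * a) ->
  deviation_bound p kappa V N u l t <= 2 * (V + 1) * expR (- (c / 2 * a)).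
Proof.
move=> N0 u1 Nu a0 au la; rewrite /deviation_bound -[leRHS]mulrA ler_pM2l// mulrDl mul1r.
have u0 : 0 < u by exact: lt_le_trans u1.
apply: lerD; last by rewrite ler_expR.
have -> : N * (V * u ^- 2 * expR (- (u `^ p / kappa))) =
    V * (N / u ^+ 2) * expR (- (u `^ p / kappa)) by ring.
apply: ler_pM; rewrite ?expR_ge0//.
- by rewrite mulr_ge0 ?divr_ge0 ?sqr_ge0// ltW.
- rewrite -[leRHS]mulr1 ler_pM2l// ler_pdivrMr ?exprn_gt0// mul1r.
  rewrite (le_trans Nu)// -(powR_mulrn 2 (ltW u0)) ler_powR//.
  by rewrite lerBlDr lerDl ltW.
rewrite ler_expR lerN2 mulrC [leRHS]mulrC.
apply: (@le_trans _ _ (kappa^-1 * a)); last first.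
  by rewrite ler_wpM2l// invr_ge0 ltW.
rewrite mulrC ler_wpM2r//; have := ck; have := c0; lra.
Qed.

(** The threshold u0 = N^(1/(2-p)) for t = N x corresponds to the threshold
    th = u0^-(1-p) for x; both regimes rely on N = u0^(2-p). *)
Variables (n : nat) (n1 : (1 <= n)%N).
Let N : R := n%:R.
Let N1 : 1 <= N. Proof. by rewrite ler1n. Qed.
Let N0 : 0 < N. Proof. exact: lt_le_trans N1. Qed.
Let th := N `^ (- ((1 - p) / (2 - p))).
Let u0 := N `^ (2 - p)^-1.

Let q0 : 0 < 2 - p. Proof. have := p1; lra. Qed.
Let u01 : 1 <= u0.
Proof. by rewrite -(powRr0 N) ler_powR// invr_ge0 ltW. Qed.
Let u00 : 0 < u0. Proof. exact: lt_le_trans u01. Qed.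
Let NE : N = u0 `^ (2 - p).
Proof. by rewrite /u0 -powRrM mulVf ?gt_eqF// powRr1// ltW. Qed.
Let thE : th = u0 `^ (- (1 - p)).
Proof. by rewrite /th /u0 -powRrM; congr (_ `^ _); rewrite mulrN mulrC. Qed.

(** Here u = t, and l = c t^(p-1) is the largest parameter allowed; the quadratic
    term N l^2 V is at most half the linear one, as N <= t^(2-p) and
    c V <= 1/2. *)
Lemma large_deviation_rate x : th <= x ->
  exists u l, [/\ 0 < u, 0 <= l, l * u `^ (1 - p) <= kappa^-1 &
    deviation_bound p kappa V N u l (N * x) <=
      2 * (V + 1) * expR (- (N `^ p * (c / 2) * x `^ p))].
Proof.
move=> thx.
have x0 : 0 <= x by rewrite (le_trans _ thx)// powR_ge0.
pose t := N * x.
have ut : u0 <= t.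
  apply: (@le_trans _ _ (N * th)); last by rewrite ler_pM2l.
  rewrite NE thE -powRD; last by rewrite (gt_eqF u00) implybT.
  rewrite (_ : 2 - p + - (1 - p) = 1); last by ring.
  by rewrite (powRr1 (ltW u00)).
have t1 : 1 <= t by exact: le_trans ut.
have t0 : 0 < t by exact: lt_le_trans t1.
have Nt : N <= t `^ (2 - p).
  by rewrite NE ge0_ler_powR ?nnegrE// ltW.
have tp0 := powR_gt0 p t0.
exists t, (c * t `^ (p - 1)); split => //.
- by rewrite mulr_ge0 ?powR_ge0// ltW.
- rewrite -mulrA -powRD; last by rewrite (gt_eqF t0) implybT.
  rewrite (_ : p - 1 + (1 - p) = 0); last by ring.
  by rewrite powRr0 mulr1.
have -> : N `^ p * (c / 2) * x `^ p = c / 2 * t `^ p.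
  by rewrite /t (powRM _ (ltW N0) x0); ring.
apply: deviation_bound_le => //; rewrite ?(ltW N0) ?(ltW tp0)//.
have e1 : c * t `^ (p - 1) * (N * x) = c * t `^ p.
  rewrite -mulrA -/t -[X in _ * (_ * X)](powRr1 (ltW t0)) -powRD.
    by rewrite subrK.
  by rewrite (gt_eqF t0) implybT.
have e2 : N * ((c * t `^ (p - 1)) ^+ 2 * V) <= c / 2 * t `^ p.
  have h : N * (t `^ (p - 1)) ^+ 2 <= t `^ p.
    apply: (@le_trans _ _ (t `^ (2 - p) * (t `^ (p - 1)) ^+ 2)).
      by rewrite ler_wpM2r ?sqr_ge0.
    rewrite expr2 -!powRD ?(gt_eqF t0) ?implybT//.
    by rewrite (_ : 2 - p + (p - 1 + (p - 1)) = p)//; ring.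
  have -> : N * ((c * t `^ (p - 1)) ^+ 2 * V) =
     c * (c * V) * (N * (t `^ (p - 1)) ^+ 2) by ring.
  apply: ler_pM => //.
  - by apply: mulr_ge0; [exact: ltW|apply: mulr_ge0; exact: ltW].
  - by apply: mulr_ge0; [exact: ltW|exact: sqr_ge0].
  - by rewrite ler_pM2l.
rewrite e1; lra.
Qed.

(** Here l = c x is the Gaussian choice, allowed at the fixed level u0 since
    x <= u0^-(1-p); and N x^2 <= u0^p, so the union bound does not spoil the
    Gaussian rate. *)
Lemma moderate_deviation_rate x : 0 <= x <= th ->
  exists u l, [/\ 0 < u, 0 <= l, l * u `^ (1 - p) <= kappa^-1 &
    deviation_bound p kappa V N u l (N * x) <=
      2 * (V + 1) * expR (- (N * (c / 2) * x ^+ 2))].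
Proof.
move=> /andP[x0 xth].
exists u0, (c * x); split => //.
- by rewrite mulr_ge0// ltW.
- rewrite (le_trans _ ck)// -mulrA -[leRHS]mulr1 ler_pM2l//.
  apply: (@le_trans _ _ (th * u0 `^ (1 - p))).
    by rewrite ler_wpM2r ?powR_ge0.
  rewrite thE -powRD ?(gt_eqF u00) ?implybT//.
  by rewrite addNr powRr0.
have -> : N * (c / 2) * x ^+ 2 = c / 2 * (N * x ^+ 2) by ring.
apply: deviation_bound_le => //; rewrite ?(ltW N0)//.
- by rewrite -NE.
- by apply: mulr_ge0; [exact: ltW|exact: sqr_ge0].
- apply: (@le_trans _ _ (N * th ^+ 2)).
    by rewrite ler_pM2l// lerXn2r ?nnegrE ?powR_ge0.
  rewrite {1}NE thE expr2 -!powRD ?(gt_eqF u00) ?implybT//.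
  by rewrite (_ : 2 - p + (- (1 - p) + - (1 - p)) = p)//; ring.
have : N * x ^+ 2 * c * (c * V) <= N * x ^+ 2 * c * 2^-1.
  apply: ler_wpM2l => //; apply: mulr_ge0; last exact: ltW.
  by apply: mulr_ge0; [exact: ltW|exact: sqr_ge0].
rewrite !expr2; lra.
Qed.

End rates.

(** * The theorem *)

Theorem mainTheorem19 (R : realType)
  (XX YY : completeMetricType R)
  (sepX : separable XX) (sepY : separable YY)
  (d : measure_display) (Omega : measurableType d) (P : probability Omega R)
  (eps : nat -> {RV P >-> borel YY})
  (eps_indep : mutually_independent [set i | (1 <= i)%N] eps)
  (eps_id : identically_distributed [set i | (1 <= i)%N] eps)
  (X : nat -> {RV P >-> borel XX})
  (X1_indep : independent_of_family (X 1%N) [set i | (2 <= i)%N] eps)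
  (F : XX * YY -> XX)
  (measF : measurable_fun [set: borel XX * borel YY]
             (F : borel XX * borel YY -> borel XX))
  (chain : forall n, (2 <= n)%N -> forall w, X n w = F (X n.-1 w, eps n w))
  (rho C : R) (rho0 : 0 <= rho) (rho1 : rho < 1) (C_gt0 : 0 < C)
  (contraction : forall x x' : XX,
     (\int[P]_w (mdist (F (x, eps 1%N w)) (F (x', eps 1%N w)))%:E
        <= (rho * mdist x x')%:E)%E)
  (lipschitz : forall (x : XX) (y y' : YY),
     mdist (F (x, y)) (F (x, y')) <= C * mdist y y')
  (mu : probability (borel XX) R)
  (mu_inv : invariant_law F (distribution P (eps 1%N)) mu)
  (p : R) (p0 : 0 < p) (p1 : p < 1)
  (K1 K2 : R) (K1_gt0 : 0 < K1) (K2_gt0 : 0 < K2)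
  (momentX : let G := mean_dist 1 (distribution P (X 1%N)) in
     (\int[P]_w (G (X 1%N w) ^+ 2 * expeR (G (X 1%N w) `^ p)) <= K1%:E)%E)
  (momenteps : let G := mean_dist C (distribution P (eps 1%N)) in
     (\int[P]_w (G (eps 1%N w) ^+ 2 * expeR (G (eps 1%N w) `^ p))
        <= K2%:E)%E) :
  let W n w := W1 (empirical n (fun k => X k w)) mu in
  let tail n x :=
    P [set w | (x%:E < `|W n w - \int[P]_w' W n w'|)%E] in
  exists A B C0 D L : R,
    [/\ 0 < A, 0 < B, 0 < C0, 0 < D & 0 < L] /\
    forall n : nat, (1 <= n)%N -> forall x : R,
      (L * n%:R `^ (- ((1 - p) / (2 - p))) <= x ->
         (tail n x <= (C0 * expR (- (n%:R `^ p * A * x `^ p)))%:E)%E) /\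
      (0 <= x <= L * n%:R `^ (- ((1 - p) / (2 - p))) ->
         (tail n x <= (D * expR (- (n%:R * B * x ^+ 2)))%:E)%E).
Proof.
(* The constants K1 and K2 are merged, and the indices shifted by one: the n
   states X 1, ..., X n are Z 0, ..., Z n.-1. *)
pose dT : borel XX -> borel XX -> R := fun x y => 1 * mdist (x : XX) y.
pose dS : borel YY -> borel YY -> R := fun x y => C * mdist (x : YY) y.
have HT : measurable_distance dT := measurable_distance_metric sepX ltr01.
have HS : measurable_distance dS := measurable_distance_metric sepY C_gt0.
pose nu := distribution P (eps 1%N).
pose mu0 := distribution P (X 1%N).
pose K := K1 + K2.
have K_gt0 : 0 < K by rewrite addr_gt0.
have momS : moment_bound nu dS p K.
  apply: (moment_bound_law HS (V := eps 1%N) (P := P)) => //.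
  by apply: (le_trans momenteps); rewrite lee_fin lerDr ltW.
have momT : moment_bound mu0 dT p K.
  apply: (moment_bound_law HT (V := X 1%N) (P := P)) => //.
  by apply: (le_trans momentX); rewrite lee_fin lerDl ltW.
pose kappa := (1 - rho)^-1.
have rho' : 0 < 1 - rho by rewrite subr_gt0.
have kappa1 : 1 <= kappa by rewrite invf_ge1// lerBlDr lerDl.
have kappaE : 1 + kappa * rho <= kappa.
  rewrite le_eqVlt; apply/orP; left; apply/eqP.
  by rewrite /kappa; field; rewrite gt_eqF.
have FS (x : borel XX) (y y' : borel YY) : dT (F (x, y)) (F (x, y')) <= dS y y'.
  by rewrite /dT mul1r; exact: lipschitz.
have mFx (x : borel XX) : measurable_fun setT (fun y : borel YY => F (x, y) : borel XX).
  by apply: (measurableT_comp measF); exact: measurable_fun_pair.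
have FT (x x' : borel XX) :
    (\int[nu]_y (dT (F (x, y)) (F (x', y)))%:E <= (rho * dT x x')%:E)%E.
  have law A : measurable A -> P (eps 1%N @^-1` A) = nu A by [].
  rewrite -(ge0_integral_law (V := eps 1%N) (P := P) _ law) //; last 2 first.
  - by apply/measurable_EFinP; apply: (measurable_distance2 HT).
  - by move=> y; rewrite lee_fin (distance_ge0 HT).
  rewrite /dT; under eq_integral do rewrite mul1r.
  by rewrite mul1r; exact: contraction.
pose x0 : borel XX := point.
have mu_fin : (\int[mu]_y (mdist (x0 : XX) y)%:E < +oo)%E.
  have := invariant_first_moment measF mu_inv x0 HT HS (rho := rho)
    (y0 := point : borel YY) _ FS FT (mean_distance_fin_num HS p0 momS _).
  rewrite rho0 rho1 /dT => /(_ isT).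
  by under eq_integral do rewrite mul1r.
pose Z k : Omega -> borel XX := X k.+1.
pose e k : Omega -> borel YY := eps k.+1.
have e_law k A : measurable A -> distribution P (eps k.+2) A = nu A.
  by move=> mA; exact: eps_id.
have dev n f := @chain_deviation_abs R _ _ (borel XX) (borel YY) dT HT dS HS
  F measF nu p p0 p1 K momS rho kappa kappa1 kappaE FS FT mu0 momT _ Omega P Z e
  (fun A _ => erefl) (fun k w => chain k.+2 erefl w)
  (history (X 1%N) eps) (@history_sub _ _ _ _ _ _ _ _ (X 1%N) eps)
  (@history_mono _ _ _ _ _ _ _ _ (X 1%N) eps)
  (@history_X1 _ _ _ _ _ _ _ _ (X 1%N) eps)
  (@history_eps _ _ _ _ _ _ _ _ (X 1%N) eps)
  (fun n B A hB mA => etrans (history_independent eps_indep X1_indep hB mA)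
     (congr1 (fun q => (P B * q)%E) (e_law n A mA))) n f.
pose V := kappa ^+ 2 * K.
have V0 : 0 < V by rewrite mulr_gt0// exprn_gt0// (lt_le_trans ltr01).
move=> W tail.
(* The shift z k.-1 matches the convention of [empirical], which reads the
   points from index 1 on. *)
pose f n (z : nat -> borel XX) : R := n%:R * rW1 n mu (fun k => z k.-1 : XX).
have f_lip m : lip dT kappa m (f m.+1).
  move=> z z'; rewrite /f -mulrBr normrM ger0_norm//.
  have h := rW1_lipschitz sepX (ltn0Sn m) mu_fin (fun k => z k.-1) (fun k => z' k.-1).
  apply: (@le_trans _ _ (\sum_(k < m.+1) mdist (z k : XX) (z' k))).
    rewrite -ler_pdivlMl ?ltr0n//.
  rewrite big_ord_recr/=; apply: lerD.
    by apply: ler_sum => k _; rewrite /dT mul1r.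
  by rewrite /dT mul1r ler_peMl// mdist_ge0.
have fW m w : (f m.+1 (Z ^~ w))%:E = (m.+1%:R%:E * W m.+1 w)%E.
  rewrite /f EFinM; congr (_ * _)%E; rewrite /rW1 fineK//.
  exact: (W1_empirical_fin_num sepX (ltn0Sn m) _ mu_fin).
have tail_le m x u l : 0 < u -> 0 <= l -> l * u `^ (1 - p) <= kappa^-1 ->
    (tail m.+1 x <= (deviation_bound p kappa V m.+1%:R u l (m.+1%:R * x))%:E)%E.
  move=> u0 l0 lu.
  have [fint fdev] := dev m (f m.+1) (f_lip m).
  apply: le_trans (fdev u l (m.+1%:R * x) u0 l0 lu).
  have n0 : (m.+1%:R : R) != 0 by rewrite pnatr_eq0.
  have WE w : W m.+1 w = (m.+1%:R^-1 * f m.+1 (Z ^~ w))%:E.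
    by rewrite EFinM fW muleA -EFinM mulVf// mul1e.
  have EW : (\int[P]_w W m.+1 w =
      (m.+1%:R^-1 * \int[P]_w f m.+1 (Z ^~ w))%:E)%E.
    under eq_integral do rewrite WE EFinM.
    rewrite integralZl// EFinM fineK//; exact: integrable_fin_num.
  rewrite le_eqVlt; apply/orP; left; apply/eqP; congr (P _).
  have np : 0 < (m.+1%:R : R) by rewrite ltr0n.
  have eqv w : ((x%:E < `|W m.+1 w - \int[P]_w' W m.+1 w'|)%E =
      (m.+1%:R * x < `|f m.+1 (Z ^~ w) - \int[P]_w' f m.+1 (Z ^~ w')|)).
    rewrite EW WE -EFinB abse_EFin lte_fin -mulrBr normrM ger0_norm.
      by rewrite ltr_pdivlMl.
    by rewrite invr_ge0 ltW.
  by apply/seteqP; split => w /=; rewrite eqv.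
exists ((kappa + 2 * V)^-1 / 2), ((kappa + 2 * V)^-1 / 2),
  (2 * (V + 1)), (2 * (V + 1)), 1.
have c0 : 0 < (kappa + 2 * V)^-1 / 2.
  by rewrite divr_gt0// invr_gt0 addr_gt0// ?mulr_gt0// (lt_le_trans ltr01).
have D0 : 0 < 2 * (V + 1) by rewrite mulr_gt0// addr_gt0.
split=> [//|[//|m] n1 x]; split; rewrite mul1r => hx.
- have [u [l [u0 l0 lu bnd]]] := large_deviation_rate p0 p1 kappa1 V0 n1 hx.
  by apply: (le_trans (tail_le m x u l u0 l0 lu)); rewrite lee_fin.
- have [u [l [u0 l0 lu bnd]]] := moderate_deviation_rate p0 p1 kappa1 V0 n1 hx.
  by apply: (le_trans (tail_le m x u l u0 l0 lu)); rewrite lee_fin.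
Qed.
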